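(* Let $\Omega\subsetneq\mathbb{C}$ be a domain, let $K_\Omega(z)$ denote its Bergman kernel on the diagonal and $\delta_\Omega(z)=\operatorname{dist}(z,\partial\Omega)$. All inequalities below are assumed to hold for all $z\in\Omega$ with $\delta_\Omega(z)$ sufficiently small (i.e. as $z\to\partial\Omega$). (1) If $\Omega$ is bounded and there is a constant $c>0$ with $K_\Omega(z)\ge c\,\delta_\Omega(z)^{-2}$ as $z\to\partial\Omega$, then $\partial\Omega$ is uniformly perfect. (2) If there is a constant $M>0$ with $K_\Omega(z)\ge \dfrac{M}{\delta_\Omega(z)^2\log\frac{1}{\delta_\Omega(z)}}$ as $z\to\partial\Omega$, then there exists $\alpha>1$ such that $\partial\Omega$ satisfies condition $(U)_{1,\alpha}$. If moreover $M>\frac{1}{2\pi}$, then $\alpha$ can be chosen in $(1,2)$. (3) If there is a constant $c>0$ with $K_\Omega(z)\ge \dfrac{c}{\delta_\Omega(z)^2\log\log\frac{1}{\delta_\Omega(z)}}$ as $z\to\partial\Omega$, then there exists $\beta>0$ such that $\partial\Omega$ satisfies condition $(U)_{2,\beta}$.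
   Context: The Bergman kernel $K_\Omega(z)=K_\Omega(z,z)$ is the reproducing kernel on the diagonal of the Bergman space $A^2(\Omega)$ of holomorphic functions on $\Omega$ that are square integrable with respect to Lebesgue measure. A closed set $K\subset\mathbb{C}$ is uniformly perfect if there is a constant $C\in(0,1)$ such that $\{z\in\mathbb{C}: Cr\le|z-a|\le r\}\cap K\neq\emptyset$ for every $a\in K$ and every $r\in(0,\operatorname{diam}(K))$. For an increasing function $h$ on $[0,r_0)$ with $h(r)\le r$, a closed set $K\subset\mathbb{C}$ is $h$-uniformly perfect if $\{z\in\mathbb{C}: h(r)\le|z-a|\le r\}\cap K\neq\emptyset$ for every $a\in K$ and every $r\in(0,r_0)$. Let $h_{1,\alpha}(r)=r^\alpha$ ($\alpha>1$) and $h_{2,\beta}(r)=r(-\log r)^{-\beta}$ ($\beta>0$). A closed set satisfies condition $(U)_{1,\alpha}$ (resp. $(U)_{2,\beta}$) if there exist constants $C>0$ and $r_0>0$ such that it is $Ch_{1,\alpha}$-uniformly perfect (resp. $Ch_{2,\beta}$-uniformly perfect) with that $r_0$. *)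

(* Defs.v *)
(* The complex plane is modelled by mathcomp's
   [complex R] (= R[i]) for an arbitrary [R : realType], seen through the
   alias [^o] so that it carries its normed-field (Euclidean) topology and
   complex differentiability ([derivable f z 1] over the scalar field R[i]). *)
From HB Require Import structures.
From mathcomp Require Import all_boot all_order all_algebra.
From mathcomp Require Import all_classical all_reals all_analysis.
From mathcomp Require Import complex.
Import Order.TTheory GRing.Theory Num.Theory.
Import numFieldNormedType.Exports.

Set Implicit Arguments.
Unset Strict Implicit.
Unset Printing Implicit Defensive.

Local Open Scope classical_set_scope.
Local Open Scope ring_scope.

(* The complex plane over R, with its topology / normed structure. *)
Notation cplx R := ((complex R)^o).

(* Real modulus |z|. *)
Definition cabs {R : realType} (z : cplx R) : R := Normc.normc z.

(* Identification R^2 -> C, (x,y) |-> x + i y. *)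
Definition toC {R : realType} (p : R * R) : cplx R := (p.1 +i* p.2)%C.

(* Lebesgue (area) measure on the plane R^2. *)
Notation area R := (@lebesgue_measure R \x @lebesgue_measure R)%E.

(* A set of C seen as a subset of R^2. *)
Definition planeset {R : realType} (A : set (cplx R)) : set (R * R) :=
  toC @^-1` A.

(* Holomorphic on Omega: complex differentiable at every point of Omega. *)
Definition holomorphic_on {R : realType} (Om : set (cplx R))
  (f : cplx R -> cplx R) : Prop :=
  forall z, Om z -> derivable f z 1.

(* Bergman space A^2(Omega): holomorphic and square integrable w.r.t. area. *)
Definition bergman_space {R : realType} (Om : set (cplx R))
  (f : cplx R -> cplx R) : Prop :=
  holomorphic_on Om f /\
  (area R).-integrable (planeset Om) (fun p => ((cabs (f (toC p))) ^+ 2)%:E).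

(* Integral over Omega (w.r.t. area measure) of a complex-valued function. *)
Definition cintegral {R : realType} (Om : set (cplx R))
  (g : cplx R -> cplx R) : cplx R :=
  (Rintegral (area R) (planeset Om) (fun p => complex.Re (g (toC p))) +i*
   Rintegral (area R) (planeset Om) (fun p => complex.Im (g (toC p))))%C.

(* k is the Bergman kernel K_Omega(., z): it lies in A^2(Omega) and reproduces
   values at z:  f(z) = \int_Omega f(w) conj(k(w)) dA(w)  for all f in A^2. *)
Definition bergman_reproducing_at {R : realType} (Om : set (cplx R))
  (z : cplx R) (k : cplx R -> cplx R) : Prop :=
  bergman_space Om k /\
  forall f, bergman_space Om f ->
    f z = cintegral Om (fun w => f w * ((k w)^*)%C).

(* K is the Bergman kernel on the diagonal: K(z) = K_Omega(z,z). *)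
Definition bergman_kernel_diag {R : realType} (Om : set (cplx R))
  (K : cplx R -> R) : Prop :=
  forall z, Om z -> exists k, bergman_reproducing_at Om z k /\
                              K z = complex.Re (k z).

(* Topological boundary. *)
Definition boundary {R : realType} (A : set (cplx R)) : set (cplx R) :=
  closure A `\` interior A.

(* delta_Omega(z) = dist(z, boundary Omega). *)
Definition dist_boundary {R : realType} (Om : set (cplx R)) (z : cplx R) : R :=
  inf [set cabs (z - w) | w in boundary Om].

Definition bounded_cset {R : realType} (A : set (cplx R)) : Prop :=
  exists M : R, forall z, A z -> cabs z <= M.

(* Diameter, as an extended real (possibly +oo). *)
Definition diam {R : realType} (K : set (cplx R)) : \bar R :=
  ereal_sup [set (cabs (x - y))%:E | x in K & y in K].

(* Uniformly perfect closed set. *)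
Definition uniformly_perfect {R : realType} (K : set (cplx R)) : Prop :=
  exists C : R, 0 < C < 1 /\
    forall a, K a -> forall r : R, 0 < r -> (r%:E < diam K)%E ->
      exists z, K z /\ C * r <= cabs (z - a) <= r.

(* h-uniformly perfect with radius r0. *)
Definition h_uniformly_perfect {R : realType} (h : R -> R) (r0 : R)
  (K : set (cplx R)) : Prop :=
  forall a, K a -> forall r : R, 0 < r < r0 ->
    exists z, K z /\ h r <= cabs (z - a) <= r.

Definition h1 {R : realType} (alpha : R) (r : R) : R := r `^ alpha.
Definition h2 {R : realType} (beta : R) (r : R) : R :=
  r * (- ln r) `^ (- beta).

(* Condition (U)_{1,alpha}. *)
Definition condU1 {R : realType} (alpha : R) (K : set (cplx R)) : Prop :=
  exists C r0 : R, 0 < C /\ 0 < r0 < 1 /\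
    h_uniformly_perfect (fun r => C * h1 alpha r) r0 K.

(* Condition (U)_{2,beta}. *)
Definition condU2 {R : realType} (beta : R) (K : set (cplx R)) : Prop :=
  exists C r0 : R, 0 < C /\ 0 < r0 < 1 /\
    h_uniformly_perfect (fun r => C * h2 beta r) r0 K.

(* "P(z) holds for all z in Omega with delta_Omega(z) sufficiently small". *)
Definition near_boundary {R : realType} (Om : set (cplx R))
  (P : cplx R -> Prop) : Prop :=
  exists eps : R, 0 < eps /\
    forall z, Om z -> dist_boundary Om z < eps -> P z.

(* Main.v *)
(**
Let [a] be a boundary point and suppose that the boundary misses the annulus
[s <= |z - a| <= r]. Since the domain is connected, either it lies in the disc
of radius [r], which is impossible for the radii considered, or it contains
the annulus. In the second case let [z0] be the point [a + rho] of the annulus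
and [k] the Bergman kernel at [z0], so that [K z0 = k z0 = \int |k|^2].

Cauchy's formula on the annulus expresses [k z0] by two circle integrals.
The residue of [k] around [a] is the same on every circle, so by Cauchy-Schwarz
and integration in polar coordinates its square is at most
[K z0 / (2 pi ln (r / s))]; what remains is controlled on one circle near each
rim on which the integral of [|z - a|^2 |k|^2 dt] does not exceed [2 K z0].
With [X = ln (r / rho)] and [Y = ln (rho / s)] this gives
[rho * sqrt (2 pi K z0) <= 1 / sqrt (X + Y) + 3 (1 / X + 1 / Y)].
The first term has the sharp constant responsible for the threshold
[1 / (2 pi)]. The distance from [z0] to the boundary lies between [rho / 2] and
[rho], so a lower bound on the kernel contradicts this inequality for small [r],
with [s = q^2 r], [rho = q r] in part (1), [s = r^(1 + g)], [rho = r^(1 + e)]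
in part (2), and [s = r L^(- b)], [rho = r L^(- b / 2)], [L = - ln r], in part (3).

Cauchy's theorem is proved in the coordinates [z = a + exp (u + i t)], where a
holomorphic function satisfies the Cauchy-Riemann equations in [(u, t)] and
Goursat's bisection applies to coordinate rectangles.
*)
Require Import Defs.
From HB Require Import structures.
From mathcomp Require Import all_boot all_order all_algebra.
From mathcomp Require Import all_classical all_reals all_analysis.
From mathcomp Require Import complex.
From mathcomp Require Import measurable_realfun.
From mathcomp Require Import ring lra.
Import Order.TTheory GRing.Theory Num.Theory.
Import numFieldNormedType.Exports.
Local Open Scope classical_set_scope.
Local Open Scope ring_scope.

Set Implicit Arguments.
Unset Strict Implicit.
Unset Printing Implicit Defensive.

(** The leading term of the estimate comes from the residue. Among the Laurent modes of the kernel
    around [a], only [1 / (z - a)] has its square norm spread evenly over [ln |z - a|]; every other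
    mode concentrates near a rim and costs only [1 / X + 1 / Y]. When [X] and [Y] are proportional
    to [X + Y], this is of lower order than [1 / sqrt (X + Y)], so the crude factor 3 is harmless.
    In part (2) the inequality tends to [2 pi M <= (1 + e) / g] as [r] tends to 0; with [e] small it
    fails as soon as [2 pi M g > 1], and such a [g] can be taken below 1 exactly when
    [M > 1 / (2 pi)].

    Complex derivability comes without continuity of the derivative, which rules out Green's formula
    and explains the bisection argument. Square norms over the domain enter only through lower
    bounds, so polar coordinates are established as an inequality: the plane is cut into four
    sectors, the diagonals are dropped, and each sector is treated by substitutions in one variable
    at a time under Tonelli's theorem. *)

Section segment_integrals.
Context {R : realType}.
Notation mu := (@lebesgue_measure R).
Implicit Types (f g : R -> R) (a b c : R).

(** Two-sided continuity at every point of the closed segment, end points included. It is stronger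
    than continuity within the segment, and sums and products then need no subspace topology. *)
Definition cts a b f := forall x, a <= x <= b -> {for x, continuous f}.

Lemma cts_within a b f : cts a b f -> {within `[a, b], continuous f}.
Proof. by move=> cf; apply: continuous_in_subspaceT => x /set_mem/=; rewrite in_itv/= => /cf. Qed.

Lemma cts_integrable a b f : cts a b f -> mu.-integrable `[a, b] (EFin \o f).
Proof. by move/cts_within; apply: continuous_compact_integrable; exact: segment_compact. Qed.

Lemma ctsD a b f g : cts a b f -> cts a b g -> cts a b (fun x => f x + g x).
Proof. by move=> cf cg x xab; apply: cvgD; [exact: cf|exact: cg]. Qed.

Lemma ctsM a b f g : cts a b f -> cts a b g -> cts a b (fun x => f x * g x).
Proof. by move=> cf cg x xab; apply: cvgM; [exact: cf|exact: cg]. Qed.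

Lemma cts_cst a b k : cts a b (fun=> k).
Proof. by move=> x _; exact: cst_continuous. Qed.

Lemma cts_id a b : cts a b id.
Proof. by move=> x _; exact: cvg_id. Qed.

Lemma ctsN a b f : cts a b f -> cts a b (fun x => - f x).
Proof. by move=> cf x xab; apply: cvgN; exact: cf. Qed.

Definition rint a b f : R := Rintegral mu `[a, b] f.

Lemma rintD a b f g : cts a b f -> cts a b g ->
  rint a b (fun x => f x + g x) = rint a b f + rint a b g.
Proof. by move=> cf cg; apply: RintegralD => //; exact: cts_integrable. Qed.

Lemma rintB a b f g : cts a b f -> cts a b g ->
  rint a b (fun x => f x - g x) = rint a b f - rint a b g.
Proof. by move=> cf cg; apply: RintegralB => //; exact: cts_integrable. Qed.

Lemma rintZ a b k f : cts a b f -> rint a b (fun x => k * f x) = k * rint a b f.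
Proof. by move=> cf; apply: RintegralZl => //; exact: cts_integrable. Qed.

Lemma rint_le a b f g : cts a b f -> cts a b g ->
  (forall x, a <= x <= b -> f x <= g x) -> rint a b f <= rint a b g.
Proof.
by move=> cf cg fg; apply: le_Rintegral => //; exact: cts_integrable.
Qed.

Lemma eq_rint a b f g :
  (forall x, a <= x <= b -> f x = g x) -> rint a b f = rint a b g.
Proof. by move=> fg; apply: eq_Rintegral => x /set_mem/=; rewrite in_itv/=; exact: fg. Qed.

Lemma rint_cst a b k : a <= b -> rint a b (fun=> k) = k * (b - a).
Proof.
move=> ab; rewrite /rint Rintegral_cst//= lebesgue_measure_itv/= lte_fin.
by case: ltP => [//|ba]/=; rewrite (@le_anti _ _ a b) ?ab// subrr.
Qed.

Lemma rint_split a b c f : a <= c <= b -> cts a b f ->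
  rint a b f = rint a c f + rint c b f.
Proof.
move=> /andP[ac cb] cf.
have := @Rintegral_itvB _ f (BLeft a) (BRight b) c (cts_integrable cf).
rewrite !bnd_simp => /(_ ac cb) /eqP; rewrite subr_eq => /eqP.
rewrite -/(rint a b f) -/(rint a c f) addrC => ->; congr (_ + _).
rewrite Rintegral_itv_obnd_cbnd//.
apply: integrableS (cts_integrable cf) => //.
by apply: subset_itv; rewrite bnd_simp.
Qed.

Lemma rint_norm_le a b f M : a <= b -> cts a b f ->
  (forall x, a <= x <= b -> `|f x| <= M) -> `|rint a b f| <= M * (b - a).
Proof.
move=> ab cf fM; rewrite ler_norml -mulNr -!rint_cst//.
by apply/andP; split; apply: rint_le => //; do ?[exact: cts_cst];
  move=> x /fM; rewrite ler_norml => /andP[].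
Qed.

(** The closed form lets the contour integral of an affine closed form be seen to vanish by plain
    algebra in [goursat]. *)
Lemma rint_affine a b k l : a <= b ->
  rint a b (fun x => k + l * x) = k * (b - a) + l * (b ^+ 2 - a ^+ 2) / 2.
Proof.
move=> ab; have caf : cts a b (fun x => k + l * x).
  by apply: ctsD; [exact: cts_cst|apply: ctsM; [exact: cts_cst|exact: cts_id]].
move: ab; rewrite le_eqVlt => /predU1P[<-|ab].
  by rewrite /rint set_itv1 Rintegral_set1 !subrr; lra.
pose F x := k * x + l / 2 * x ^+ 2.
have dF (x : R) : is_derive x 1 F (k + l * x).
  rewrite /F; apply: is_derive_eq; rewrite /= !scaler1/= /GRing.scale/=.
  by lra.
rewrite /rint /Rintegral (@continuous_FTC2 _ _ F)//=.
- by rewrite /F; lra.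
- exact: cts_within.
- have cF x : {for x, continuous F}.
    by apply: differentiable_continuous; apply/derivable1_diffP; case: (dF x).
  split; first by move=> x _; case: (dF x).
  + exact: cvg_at_right_filter (cF a).
  + exact: cvg_at_left_filter (cF b).
- by move=> x _; rewrite derive1E; case: (dF x).
Qed.

End segment_integrals.

(** * Bisection of rectangles for additive set functions *)

Section bisection.
Context {R : realType}.

Lemma nested_limit (u l : nat -> R) :
  (forall n, u n <= u n.+1) -> (forall n, u n.+1 + l n.+1 <= u n + l n) ->
  (forall n, 0 <= l n) ->
  exists x, forall n, u n <= x <= u n + l n.
Proof.
move=> uS lS l0.
have um : {homo u : m n / (m <= n)%N >-> m <= n} by apply: homo_leq (lexx) le_trans uS.
have lm : {homo (fun n => u n + l n) : m n / (m <= n)%N >-> n <= m}.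
  by apply: homo_leq => // y x z xy yz; exact: le_trans yz xy.
have ub n m : u m <= u n + l n.
  have [mn|nm] := leqP m n.
    by rewrite (le_trans (um _ _ mn))// lerDl.
  by rewrite (le_trans _ (lm _ _ (ltnW nm)))//= lerDl.
exists (sup (range u)) => n.
have hs : has_sup (range u).
  by split; [exists (u 0%N), 0%N|exists (u 0%N + l 0%N) => _ [m _ <-]].
rewrite sup_upper_bound//=; last by exists n.
by apply: sup_le_ub => [|_ [m _ <-]//]; case: hs.
Qed.

(** Bisection uses nothing else about contour integrals, so it is carried out for an arbitrary
    function of the four coordinates of a rectangle. *)
Definition additive_rect (G : R -> R -> R -> R -> R) (a1 a2 b1 b2 : R) :=
  (forall u1 u2 t1 t2 c, a1 <= u1 -> u1 <= c -> c <= u2 -> u2 <= a2 ->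
     b1 <= t1 -> t1 <= t2 -> t2 <= b2 ->
     G u1 u2 t1 t2 = G u1 c t1 t2 + G c u2 t1 t2) /\
  (forall u1 u2 t1 t2 c, a1 <= u1 -> u1 <= u2 -> u2 <= a2 ->
     b1 <= t1 -> t1 <= c -> c <= t2 -> t2 <= b2 ->
     G u1 u2 t1 t2 = G u1 u2 t1 c + G u1 u2 c t2).

(** Pigeonhole: [G] is the sum of its values on the four quarters, so one of them carries at least a
    fourth of the size. Sides are written [a + a] and [b + b] so that halving involves no
    division. *)
Lemma additive_rect_quarter (G : R -> R -> R -> R -> R) (a1 a2 b1 b2 u t a b m : R) :
  additive_rect G a1 a2 b1 b2 -> a1 <= u -> u + (a + a) <= a2 ->
  b1 <= t -> t + (b + b) <= b2 -> 0 <= a -> 0 <= b ->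
  4 * m <= `|G u (u + (a + a)) t (t + (b + b))| ->
  exists p : R * R, [/\ u <= p.1, p.1 + a <= u + (a + a), t <= p.2,
    p.2 + b <= t + (b + b) & m <= `|G p.1 (p.1 + a) p.2 (p.2 + b)|].
Proof.
move=> [Gu Gt] h1 h2 h3 h4 a0 b0.
have [i1 i2 i3] : [/\ u <= u + a, u + a <= u + (a + a) & a1 <= u + a] by split; lra.
have [i4 i5 i6] : [/\ t <= t + b, t + b <= t + (b + b) & b1 <= t + b] by split; lra.
have i7 : u + a <= a2 by lra.
have i8 : t <= t + (b + b) by lra.
rewrite (Gu _ _ _ _ (u + a))// (Gt u (u + a) _ _ (t + b))//.
rewrite (Gt (u + a) (u + (a + a)) _ _ (t + b))// => hm.
pose Q p := m <= `|G p.1 (p.1 + a) p.2 (p.2 + b)|.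
have [q|q1] := pselect (Q (u, t)); first by exists (u, t).
have [q|q2] := pselect (Q (u, t + b)); first by exists (u, t + b); split; rewrite //= -addrA.
have [q|q3] := pselect (Q (u + a, t)); first by exists (u + a, t); split; rewrite //= -addrA.
have [q|q4] := pselect (Q (u + a, t + b)).
  by exists (u + a, t + b); split; rewrite //= -addrA.
exfalso; move: q1 q2 q3 q4; rewrite /Q/= -!addrA.
move=> /negP; rewrite -ltNge => q1 /negP; rewrite -ltNge => q2.
move=> /negP; rewrite -ltNge => q3 /negP; rewrite -ltNge => q4.
move: hm; apply/negP; rewrite -ltNge.
have tri (x y z w : R) : `|x + y + (z + w)| <= `|x| + `|y| + (`|z| + `|w|).
  by rewrite (le_trans (ler_normD _ _))// lerD// ler_normD.
by apply: le_lt_trans (tri _ _ _ _) _; clear -q1 q2 q3 q4; lra.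
Qed.

(* Goursat's bisection argument for an additive function of rectangles. *)
Lemma additive_rect_eq0 (G : R -> R -> R -> R -> R) (a1 a2 b1 b2 : R) :
  a1 <= a2 -> b1 <= b2 ->
  additive_rect G a1 a2 b1 b2 ->
  (forall u t, a1 <= u <= a2 -> b1 <= t <= b2 -> forall e : R, 0 < e ->
     exists2 d : R, 0 < d & forall u1 u2 t1 t2,
       a1 <= u1 -> u1 <= u -> u <= u2 -> u2 <= a2 ->
       b1 <= t1 -> t1 <= t -> t <= t2 -> t2 <= b2 ->
       u2 - u1 <= d -> t2 - t1 <= d ->
       `|G u1 u2 t1 t2| <= e * ((u2 - u1) + (t2 - t1)) ^+ 2) ->
  G a1 a2 b1 b2 = 0.
Proof.
move=> a12 b12 Gadd Gloc; apply/eqP/negPn/negP => G0.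
pose eta := `|G a1 a2 b1 b2|; have eta0 : 0 < eta by rewrite normr_gt0.
pose A n := (a2 - a1) / 2 ^+ n; pose B n := (b2 - b1) / 2 ^+ n.
have A0 n : 0 <= A n by rewrite divr_ge0 ?subr_ge0// exprn_ge0.
have B0 n : 0 <= B n by rewrite divr_ge0 ?subr_ge0// exprn_ge0.
have AS n : A n = A n.+1 + A n.+1.
  by rewrite /A exprS invfM -[RHS]mulrDl; field; rewrite expf_neq0.
have BS n : B n = B n.+1 + B n.+1.
  by rewrite /B exprS invfM -[RHS]mulrDl; field; rewrite expf_neq0.
pose bad n (p : R * R) := [/\ a1 <= p.1, p.1 + A n <= a2, b1 <= p.2, p.2 + B n <= b2 &
  eta / 4 ^+ n <= `|G p.1 (p.1 + A n) p.2 (p.2 + B n)|].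
(* Making badness a premise inside the sigma type gives a total choice function; the sequence [s]
   can then be defined by recursion before its members are known to be bad. *)
have step n p : {q | bad n p -> bad n.+1 q /\
   [/\ p.1 <= q.1, q.1 + A n.+1 <= p.1 + A n, p.2 <= q.2 & q.2 + B n.+1 <= p.2 + B n]}.
  apply: cid; case: (pselect (bad n p)) => [[h1 h2 h3 h4 h5]|]; last by exists p.
  have e4 : eta / 4 ^+ n = 4 * (eta / 4 ^+ n.+1).
    by rewrite [4 ^+ n.+1]exprS; field; rewrite expf_neq0.
  rewrite (AS n) in h2 h5; rewrite (BS n) in h4 h5; rewrite e4 in h5.
  have [q [q1 q2 q3 q4 q5]] := additive_rect_quarter Gadd h1 h2 h3 h4 (A0 _) (B0 _) h5.
  exists q => _; rewrite (AS n) (BS n); split; split => //.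
  - exact: le_trans h1 q1.
  - exact: le_trans q2 h2.
  - exact: le_trans h3 q3.
  - exact: le_trans q4 h4.
pose s := fix s n : R * R := if n is m.+1 then sval (step m (s m)) else (a1, b1).
have sbad n : bad n (s n).
  elim: n => [|n IH] /=; last by case: (step n (s n)) => q /= /(_ IH)[].
  by rewrite /bad /= /A /B !expr0 !divr1 ![_ + (_ - _)]addrC !subrK.
have sS n : [/\ (s n).1 <= (s n.+1).1, (s n.+1).1 + A n.+1 <= (s n).1 + A n,
    (s n).2 <= (s n.+1).2 & (s n.+1).2 + B n.+1 <= (s n).2 + B n].
  by rewrite /=; case: (step n (s n)) => q /= /(_ (sbad n))[].
have [u us] : exists u, forall n, (s n).1 <= u <= (s n).1 + A n.
  by apply: nested_limit => // n; case: (sS n).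
have [t ts] : exists t, forall n, (s n).2 <= t <= (s n).2 + B n.
  by apply: nested_limit => // n; case: (sS n).
(* The summand 1 keeps [L] positive for a degenerate rectangle. With tolerance [eta / (2 * L ^+ 2)]
   the local bound at level [n] is below [eta / 4 ^+ n], against badness. *)
have L0 : 0 < a2 - a1 + (b2 - b1) + 1 by lra.
set L := a2 - a1 + (b2 - b1) + 1 in L0.
have [|||d d0 dG] := Gloc u t _ _ (eta / (2 * L ^+ 2)).
- by have := us 0%N; rewrite /= /A expr0 divr1 [_ + (_ - _)]addrC subrK.
- by have := ts 0%N; rewrite /= /B expr0 divr1 [_ + (_ - _)]addrC subrK.
- by rewrite divr_gt0// mulr_gt0// exprn_gt0.
have [n nd] : exists n, L / 2 ^+ n <= d.
  pose n := (Num.truncn (L / d)).+1; exists n.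
  have Ln : L / d < n%:R by rewrite /n truncnS_gt.
  rewrite ler_pdivrMr ?exprn_gt0// mulrC -ler_pdivrMr// (le_trans (ltW Ln))//.
  by rewrite -natrX ler_nat ltnW// ltn_expl.
have [h1 h2 h3 h4 h5] := sbad n.
have /andP[u1 u2] := us n; have /andP[t1 t2] := ts n.
have n2 : 0 < 2 ^+ n :> R by rewrite exprn_gt0.
have Ad : A n <= d.
  by apply: le_trans nd; rewrite ler_pM2r ?invr_gt0//; rewrite /L; lra.
have Bd : B n <= d.
  by apply: le_trans nd; rewrite ler_pM2r ?invr_gt0//; rewrite /L; lra.
have := dG _ _ _ _ h1 u1 u2 h2 h3 t1 t2 h4.
have eA (x y : R) : x + y - x = y by ring.
rewrite !eA => /(_ Ad Bd).
move/(le_trans h5); rewrite /A /B -mulrDl exprMn exprVn -exprM mulnC exprM.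
apply/negP; rewrite -ltNge.
rewrite (_ : 2 ^+ 2 = 4 :> R); last by rewrite expr2; lra.
rewrite mulrA ltr_pM2r ?invr_gt0 ?exprn_gt0//.
rewrite mulrAC ltr_pdivrMr ?mulr_gt0 ?exprn_gt0// ltr_pM2l//.
have M0 : 0 <= a2 - a1 + (b2 - b1) by lra.
by rewrite /L; nra.
Qed.
End bisection.

(** * Goursat's theorem for closed real differential forms on a rectangle *)

Section goursat.
Context {R : realType}.
Implicit Types (P Q : R -> R -> R).

(** Total differentiability of [P] at [(u, t)] with partial derivatives [a] and [b], measured in the
    sum norm. *)
Definition rdiff P (u t a b : R) := forall e : R, 0 < e -> exists2 d : R, 0 < d &
  forall x y, `|x - u| <= d -> `|y - t| <= d ->
    `|P x y - P u t - a * (x - u) - b * (y - t)| <= e * (`|x - u| + `|y - t|).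

Definition rcont P (u t : R) := forall e : R, 0 < e -> exists2 d : R, 0 < d &
  forall x y, `|x - u| <= d -> `|y - t| <= d -> `|P x y - P u t| <= e.

Lemma rdiff_cont P u t a b : rdiff P u t a b -> rcont P u t.
Proof.
move=> /(_ 1 ltr01)[d d0 dP] e e0.
pose M := 2 + `|a| + `|b|.
have M0 : 0 < M by rewrite /M -addrA ltr_wpDr// addr_ge0.
exists (Num.min d (e / M)) => [|x y]; first by rewrite lt_min d0 divr_gt0.
rewrite !le_min => /andP[xd xe] /andP[yd ye].
have := dP x y xd yd; rewrite mul1r => h.
rewrite (_ : P x y - P u t =
  (P x y - P u t - a * (x - u) - b * (y - t)) + (a * (x - u) + b * (y - t))); last by ring.
rewrite (le_trans (ler_normD _ _))//.
apply: le_trans (lerD h (ler_normD _ _)) _; rewrite !normrM.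
have ha : `|a| * `|x - u| <= `|a| * (e / M) by rewrite ler_wpM2l.
have hb : `|b| * `|y - t| <= `|b| * (e / M) by rewrite ler_wpM2l.
have -> : e = M * (e / M) by field; rewrite gt_eqF.
by rewrite {1}/M !mulrDl; clear -ha hb xe ye; lra.
Qed.

Lemma rcont_cont1 P u t : rcont P u t -> {for u, continuous (P ^~ t)}.
Proof.
move=> cP; apply/cvgrPdist_le => e /cP[d d0 dP].
near=> x; rewrite distrC; apply: dP; last by rewrite subrr normr0 ltW.
by rewrite distrC; near: x; exact: cvgr_dist_le.
Unshelve. all: by end_near. Qed.

Lemma rcont_cont2 P u t : rcont P u t -> {for t, continuous (P u)}.
Proof.
move=> cP; apply/cvgrPdist_le => e /cP[d d0 dP].
near=> x; rewrite distrC; apply: dP; first by rewrite subrr normr0 ltW.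
by rewrite distrC; near: x; exact: cvgr_dist_le.
Unshelve. all: by end_near. Qed.

Definition rect_cont P (a1 a2 b1 b2 : R) :=
  forall u t, a1 <= u <= a2 -> b1 <= t <= b2 -> rcont P u t.

Lemma rect_cts1 P a1 a2 b1 b2 u1 u2 t : rect_cont P a1 a2 b1 b2 ->
  a1 <= u1 -> u2 <= a2 -> b1 <= t -> t <= b2 -> cts u1 u2 (P ^~ t).
Proof.
move=> cP h1 h2 h3 h4 u /andP[h5 h6]; apply: rcont_cont1.
by apply: cP; rewrite ?h3// (le_trans h1 h5) (le_trans h6 h2).
Qed.

Lemma rect_cts2 P a1 a2 b1 b2 t1 t2 u : rect_cont P a1 a2 b1 b2 ->
  b1 <= t1 -> t2 <= b2 -> a1 <= u -> u <= a2 -> cts t1 t2 (P u).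
Proof.
move=> cP h1 h2 h3 h4 t /andP[h5 h6]; apply: rcont_cont2.
by apply: cP; rewrite ?h3// (le_trans h1 h5) (le_trans h6 h2).
Qed.

(** The integral of [P du + Q dt] along the boundary of the rectangle, counterclockwise. *)
Definition contour P Q (u1 u2 t1 t2 : R) : R :=
  rint u1 u2 (P ^~ t1) - rint u1 u2 (P ^~ t2) + (rint t1 t2 (Q u2) - rint t1 t2 (Q u1)).

Lemma contour_additive P Q a1 a2 b1 b2 :
  rect_cont P a1 a2 b1 b2 -> rect_cont Q a1 a2 b1 b2 ->
  additive_rect (contour P Q) a1 a2 b1 b2.
Proof.
move=> cP cQ; split => u1 u2 t1 t2 c h1 h2 h3 h4 h5 h6 h7; rewrite /contour.
- rewrite (@rint_split _ u1 u2 c (P ^~ t1)) ?h2//; last first.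
    by apply: (rect_cts1 cP) => //; exact: le_trans h6 h7.
  rewrite (@rint_split _ u1 u2 c (P ^~ t2)) ?h2//; last first.
    by apply: (rect_cts1 cP) => //; exact: le_trans h5 h6.
  by ring.
- rewrite (@rint_split _ t1 t2 c (Q u1)) ?h5//; last first.
    by apply: (rect_cts2 cQ) => //; exact: le_trans h2 h3.
  rewrite (@rint_split _ t1 t2 c (Q u2)) ?h5//; last first.
    by apply: (rect_cts2 cQ) => //; exact: le_trans h1 h2.
  by ring.
Qed.

Lemma contour_bound P Q a1 a2 b1 b2 u1 u2 t1 t2 M :
  rect_cont P a1 a2 b1 b2 -> rect_cont Q a1 a2 b1 b2 ->
  a1 <= u1 -> u1 <= u2 -> u2 <= a2 -> b1 <= t1 -> t1 <= t2 -> t2 <= b2 ->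
  (forall x y, u1 <= x <= u2 -> t1 <= y <= t2 -> `|P x y| <= M /\ `|Q x y| <= M) ->
  `|contour P Q u1 u2 t1 t2| <= 2 * M * ((u2 - u1) + (t2 - t1)).
Proof.
move=> cP cQ h1 h2 h3 h4 h5 h6 hM.
have u2a : a1 <= u2 by exact: le_trans h1 h2.
have u1a : u1 <= a2 by exact: le_trans h2 h3.
have t2b : b1 <= t2 by exact: le_trans h4 h5.
have t1b : t1 <= b2 by exact: le_trans h5 h6.
have k1 : `|rint u1 u2 (P ^~ t1)| <= M * (u2 - u1).
  apply: rint_norm_le => //; first exact: (rect_cts1 cP).
  by move=> x xu; case: (hM x t1) => //; rewrite lexx.
have k2 : `|rint u1 u2 (P ^~ t2)| <= M * (u2 - u1).
  apply: rint_norm_le => //; first exact: (rect_cts1 cP).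
  by move=> x xu; case: (hM x t2) => //; rewrite lexx andbT.
have k3 : `|rint t1 t2 (Q u2)| <= M * (t2 - t1).
  apply: rint_norm_le => //; first exact: (rect_cts2 cQ).
  by move=> y yt; case: (hM u2 y) => //; rewrite lexx andbT.
have k4 : `|rint t1 t2 (Q u1)| <= M * (t2 - t1).
  apply: rint_norm_le => //; first exact: (rect_cts2 cQ).
  by move=> y yt; case: (hM u1 y) => //; rewrite lexx.
have tri (x y z w : R) : `|x - y + (z - w)| <= `|x| + `|y| + (`|z| + `|w|).
  by rewrite (le_trans (ler_normD _ _))// lerD// ler_normB.
by apply: le_trans (tri _ _ _ _) _; clear -k1 k2 k3 k4; lra.
Qed.

(** The shared [b] says that the [t]-derivative of [P] is the [u]-derivative of [Q], so the
    first-order Taylor part is a closed affine form with zero contour integral. The remainder is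
    small compared with the side lengths and is integrated over sides of that size, which gives the
    quadratic bound required by bisection. *)
Theorem goursat P Q a1 a2 b1 b2 : a1 <= a2 -> b1 <= b2 ->
  (forall u t, a1 <= u <= a2 -> b1 <= t <= b2 ->
     exists a b c, rdiff P u t a b /\ rdiff Q u t b c) ->
  contour P Q a1 a2 b1 b2 = 0.
Proof.
move=> a12 b12 dPQ.
have cP : rect_cont P a1 a2 b1 b2.
  by move=> u t hu ht; have [a [b [c [/rdiff_cont]]]] := dPQ u t hu ht.
have cQ : rect_cont Q a1 a2 b1 b2.
  by move=> u t hu ht; have [a [b [c [_ /rdiff_cont]]]] := dPQ u t hu ht.
apply: additive_rect_eq0 => //; first exact: contour_additive.
move=> u t hu ht e e0.
have [a [b [c [dP dQ]]]] := dPQ u t hu ht.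
have e20 : 0 < e / 2 by rewrite divr_gt0.
have [d1 d10 {}dP] := dP _ e20; have [d2 d20 {}dQ] := dQ _ e20.
exists (Num.min d1 d2) => [|u1 u2 t1 t2 g1 g2 g3 g4 g5 g6 g7 g8]; first by rewrite lt_min d10.
rewrite !le_min => /andP[ud1 ud2] /andP[td1 td2].
(* Taylor parts at [(u, t)], with summands ordered so that [P0 ^~ t1] and [Q0 u1] have the shape of
   [rint_affine]. *)
pose P0 x y := P u t - a * u - b * t + b * y + a * x.
pose Q0 x y := Q u t - b * u - c * t + b * x + c * y.
have u12 : u1 <= u2 by exact: le_trans g3.
have t12 : t1 <= t2 by exact: le_trans g7.
have affc (k l m : R) : rect_cont (fun x y => k + l * x + m * y) a1 a2 b1 b2.
  move=> x y _ _; apply: (@rdiff_cont _ _ _ l m) => e' e'0; exists 1 => // x' y' _ _.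
  rewrite (_ : k + l * x' + m * y' - (k + l * x + m * y) - l * (x' - x) - m * (y' - y) = 0);
    last by ring.
  by rewrite normr0 mulr_ge0 ?addr_ge0// ltW.
have cP0 : rect_cont P0 a1 a2 b1 b2.
  rewrite (_ : P0 = (fun x y => (P u t - a * u - b * t) + a * x + b * y))//.
  by apply/funext => x; apply/funext => y; rewrite /P0; ring.
have cQ0 : rect_cont Q0 a1 a2 b1 b2 by exact: affc.
have E0 : contour P0 Q0 u1 u2 t1 t2 = 0.
  by rewrite /contour !rint_affine//; field.
pose P1 x y := P x y - P0 x y; pose Q1 x y := Q x y - Q0 x y.
have cB S S0 : rect_cont S a1 a2 b1 b2 -> rect_cont S0 a1 a2 b1 b2 ->
    rect_cont (fun x y => S x y - S0 x y) a1 a2 b1 b2.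
  move=> cS cS0 x y hx hy e' e'0.
  have e'2 : 0 < e' / 2 by rewrite divr_gt0.
  have [k1 k10 K1] := cS x y hx hy _ e'2; have [k2 k20 K2] := cS0 x y hx hy _ e'2.
  exists (Num.min k1 k2) => [|x' y']; first by rewrite lt_min k10.
  rewrite !le_min => /andP[l1 l2] /andP[l3 l4].
  rewrite (_ : S x' y' - S0 x' y' - (S x y - S0 x y) =
    (S x' y' - S x y) - (S0 x' y' - S0 x y)); last by ring.
  rewrite (le_trans (ler_normB _ _))//.
  by apply: le_trans (lerD (K1 _ _ l1 l3) (K2 _ _ l2 l4)) _; lra.
have -> : contour P Q u1 u2 t1 t2 = contour P1 Q1 u1 u2 t1 t2.
  rewrite -[LHS]subr0 -[X in _ - X]E0 /contour /P1 /Q1.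
  have t1b : t1 <= b2 by exact: le_trans g8.
  have t2b : b1 <= t2 by exact: le_trans t12.
  have u1a : u1 <= a2 by exact: le_trans g4.
  have u2a : a1 <= u2 by exact: le_trans u12.
  rewrite !rintB; do ?[exact: (rect_cts1 cP)|exact: (rect_cts1 cP0)|
    exact: (rect_cts2 cQ)|exact: (rect_cts2 cQ0)].
  by ring.
set L := (u2 - u1) + (t2 - t1).
apply: le_trans (@contour_bound P1 Q1 a1 a2 b1 b2 u1 u2 t1 t2 (e / 2 * L)
  (cB _ _ cP cP0) (cB _ _ cQ cQ0) g1 u12 g4 g5 t12 g8 _) _.
- move=> x y /andP[x1 x2] /andP[y1 y2].
  have xu : `|x - u| <= u2 - u1 by rewrite ler_norml; apply/andP; split; lra.
  have yt : `|y - t| <= t2 - t1 by rewrite ler_norml; apply/andP; split; lra.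
  have le2 : e / 2 * (`|x - u| + `|y - t|) <= e / 2 * L by rewrite ler_pM2l// lerD.
  split.
  + rewrite (_ : P1 x y = P x y - P u t - a * (x - u) - b * (y - t)).
      exact: le_trans (dP x y (le_trans xu ud1) (le_trans yt td1)) le2.
    by rewrite /P1 /P0; ring.
  + rewrite (_ : Q1 x y = Q x y - Q u t - b * (x - u) - c * (y - t)).
      exact: le_trans (dQ x y (le_trans xu ud2) (le_trans yt td2)) le2.
    by rewrite /Q1 /Q0; ring.
- by rewrite -/L le_eqVlt; apply/orP; left; apply/eqP; field.
Qed.

End goursat.

(** * The real modulus *)

Section complex_modulus.
Context {R : realType}.
Implicit Types z w : cplx R.

Lemma normE z : `|z : R[i]| = (cabs z)%:C%C. Proof. by case: z. Qed.

Lemma cabs_ge0 z : 0 <= cabs z.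
Proof. by case: z => a b; exact: sqrtr_ge0. Qed.
#[local] Hint Extern 0 (is_true (@Order.le _ _ _ (cabs _))) => exact: cabs_ge0 : core.

Lemma cabsM z w : cabs (z * w) = cabs z * cabs w. Proof. exact: Normc.normcM. Qed.

Lemma cabsD z w : cabs (z + w) <= cabs z + cabs w. Proof. exact: le_normcD. Qed.

Lemma cabsN z : cabs (- z) = cabs z. Proof. exact: normcN. Qed.

Lemma cabsB z w : cabs (z - w) <= cabs z + cabs w.
Proof. by rewrite -(cabsN w); exact: cabsD. Qed.

Lemma cabs_dist z w : cabs (z - w) = cabs (w - z).
Proof. by rewrite -cabsN opprB. Qed.

Lemma cabsV z : cabs z^-1 = (cabs z)^-1. Proof. exact: Normc.normcV. Qed.

Lemma cabs0 : cabs (0 : cplx R) = 0. Proof. exact: Normc.normc0. Qed.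

Lemma cabs_eq0 z : (cabs z == 0) = (z == 0).
Proof. by apply/eqP/eqP => [/Normc.eq0_normc|->]; [|exact: cabs0]. Qed.

Lemma cabs_gt0 z : (0 < cabs z) = (z != 0).
Proof. by rewrite lt_def cabs_ge0 andbT cabs_eq0. Qed.

Lemma cabs_sqr z : cabs z ^+ 2 = complex.Re z ^+ 2 + complex.Im z ^+ 2.
Proof. by case: z => a b; rewrite /cabs/= sqr_sqrtr// addr_ge0 ?sqr_ge0. Qed.

Lemma Re_le_cabs z : `|complex.Re z| <= cabs z.
Proof.
by rewrite -(ler_pXn2r (n := 2)) ?nnegrE//= cabs_sqr real_normK ?num_real// lerDl sqr_ge0.
Qed.

Lemma Im_le_cabs z : `|complex.Im z| <= cabs z.
Proof.
by rewrite -(ler_pXn2r (n := 2)) ?nnegrE//= cabs_sqr real_normK ?num_real// lerDr sqr_ge0.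
Qed.

Lemma cabs_real (x : R) : cabs (x%:C%C : cplx R) = `|x|.
Proof. by rewrite /cabs/= expr0n/= addr0 sqrtr_sqr. Qed.

Lemma cabs_imag (x : R) : cabs ((0 +i* x)%C : cplx R) = `|x|.
Proof. by rewrite /cabs/= expr0n/= add0r sqrtr_sqr. Qed.

Lemma cabs_le z : cabs z <= `|complex.Re z| + `|complex.Im z|.
Proof.
case: z => a b; have := cabsD (a%:C%C : cplx R) (0 +i* b)%C.
rewrite cabs_real cabs_imag; apply: le_trans.
rewrite le_eqVlt; apply/orP; left; apply/eqP; congr cabs.
by apply/eqP; rewrite eq_complex /= addr0 add0r !eqxx.
Qed.

Lemma lt_cabs_distD z w (x y : R) : cabs z <= x -> y <= cabs w -> y - x <= cabs (w - z).
Proof.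
move=> zx yw; rewrite lerBlDr (le_trans yw)//.
by rewrite -{1}(subrK z w) (le_trans (cabsD _ _))// lerD2l.
Qed.

End complex_modulus.
#[global] Hint Extern 0 (is_true (@Order.le _ _ _ (cabs _))) => exact: cabs_ge0 : core.

(** * Complex differentiability with real tolerances *)

Section complex_derivative.
Context {R : realType}.
Implicit Types (f g : cplx R -> cplx R) (z w D : cplx R).

(** The scalar field of the normed structure is [R[i]], so the library's tolerances and radii are
    complex numbers; this form brings them back to [R] and [cabs]. *)
Definition cdiff f z D := forall e : R, 0 < e -> exists2 d : R, 0 < d &
  forall w, cabs (w - z) <= d -> cabs (f w - f z - D * (w - z)) <= e * cabs (w - z).

Lemma derivable_cdiff f z : derivable f z 1 -> exists D, cdiff f z D.
Proof.
move=> /cvg_ex[/= D /cvgrPdist_le fD]; exists D => e e0.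
have /fD : 0 < e%:C%C :> R[i] by rewrite ltcR.
rewrite near_withinE => /nbhs_ballP[d /= d0 dD].
(* In the order of [R[i]] a positive element has zero imaginary part. *)
have [d1 d1E] : exists d1 : R, d = d1%:C%C.
  move: d0; rewrite ltcE /= => /andP[/eqP d00 _]; exists (complex.Re d).
  by apply/eqP; rewrite eq_complex/= d00 !eqxx.
have d10 : 0 < d1 by rewrite d1E ltcR in d0.
exists (d1 / 2) => [|w wz]; first by rewrite divr_gt0.
have [->|wz0] := eqVneq w z; first by rewrite !subrr mulr0 subr0 cabs0 mulr0.
have h0 : w - z != 0 by rewrite subr_eq0.
have := dD (w - z); rewrite /= => /(_ _ h0).
have bh : ball (0 : cplx R) d (w - z).
  rewrite -ball_normE /ball_/= sub0r normrN normE d1E ltcR (le_lt_trans wz)//.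
  by rewrite ltr_pdivrMr// ltr_pMr// ltr1n.
move=> /(_ bh); rewrite /GRing.scale/= mulr1 subrK normE lecR => le_e.
rewrite (_ : f w - f z - D * (w - z) = - ((D - (w - z)^-1 * (f w - f z)) * (w - z))).
  by rewrite cabsN cabsM; exact: (ler_wpM2r (cabs_ge0 _) le_e).
by rewrite mulrBl mulrAC mulVf// mul1r opprB.
Qed.

End complex_derivative.

(** * Goursat's theorem with one exceptional point *)

Section removable_point.
Context {R : realType}.
Implicit Types (P Q : R -> R -> R).

(** A square of half-side [eta] around the exceptional point is cut out. The strips to its left and
    right, then those below and above it, avoid the point and contribute 0; continuity bounds what
    is left by [8 * M * eta]. This serves the difference quotient in Cauchy's formula, which is only
    known to be continuous at its base point. *)
Lemma goursat_except P Q (a1 a2 b1 b2 p q : R) :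
  a1 < p -> p < a2 -> b1 < q -> q < b2 ->
  rect_cont P a1 a2 b1 b2 -> rect_cont Q a1 a2 b1 b2 ->
  (forall u t, a1 <= u <= a2 -> b1 <= t <= b2 -> (u, t) != (p, q) ->
     exists a b c, rdiff P u t a b /\ rdiff Q u t b c) ->
  contour P Q a1 a2 b1 b2 = 0.
Proof.
move=> a1p pa2 b1q qb2 cP cQ dPQ.
pose M := `|P p q| + `|Q p q| + 1.
have M0 : 0 < M by rewrite /M ltr_wpDl// addr_ge0.
have hp : a1 <= p <= a2 by rewrite !ltW.
have hq : b1 <= q <= b2 by rewrite !ltW.
have [d1 d10 D1] := cP p q hp hq 1 ltr01.
have [d2 d20 D2] := cQ p q hp hq 1 ltr01.
pose m := Num.min (Num.min (Num.min d1 d2) (Num.min (p - a1) (a2 - p)))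
  (Num.min (q - b1) (b2 - q)).
have m0 : 0 < m by rewrite /m !lt_min d10 d20 !subr_gt0 a1p pa2 b1q qb2.
have bnd eta : 0 < eta -> eta <= m ->
    `|contour P Q a1 a2 b1 b2| <= 8 * M * eta.
  move=> eta0; rewrite /m !le_min => /andP[/andP[/andP[ed1 ed2] /andP[l1 l2]] /andP[l3 l4]].
  have [k1 k2 k3 k4] : [/\ a1 <= p - eta, p + eta <= a2, b1 <= q - eta & q + eta <= b2].
    by clear -l1 l2 l3 l4; split; lra.
  have [k5 k6 k7 k8] : [/\ p - eta < p, p < p + eta, q - eta < q & q < q + eta].
    by clear -eta0; split; lra.
  have k9 : p - eta <= p + eta by rewrite ltW// (lt_trans k5).
  have k10 : q - eta <= q + eta by rewrite ltW// (lt_trans k7).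
  have [Gu Gt] := contour_additive cP cQ.
  have zero u1 u2 t1 t2 : a1 <= u1 -> u1 <= u2 -> u2 <= a2 -> b1 <= t1 -> t1 <= t2 ->
      t2 <= b2 -> (u2 < p \/ p < u1) \/ (t2 < q \/ q < t1) ->
      contour P Q u1 u2 t1 t2 = 0.
    move=> h1 h2 h3 h4 h5 h6 out; apply: goursat => // u t /andP[u1u uu2] /andP[t1t tt2].
    apply: dPQ.
    - by rewrite (le_trans h1 u1u) (le_trans uu2 h3).
    - by rewrite (le_trans h4 t1t) (le_trans tt2 h6).
    - apply/eqP => -[up tq]; subst u t.
      by case: out => -[]; rewrite ltNge ?uu2 ?u1u ?t1t ?tt2.
  have e1 : contour P Q a1 a2 b1 b2 = contour P Q (p - eta) (p + eta) b1 b2.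
    rewrite (Gu a1 a2 b1 b2 (p - eta))//; do ?[by rewrite ltW// (lt_trans b1q)|
      by apply: le_trans k9 k2].
    rewrite zero ?add0r//; [|by rewrite (le_trans k9)|by rewrite ltW// (lt_trans b1q)|by left; left].
    rewrite (Gu (p - eta) a2 b1 b2 (p + eta))//; last by rewrite ltW// (lt_trans b1q).
    rewrite [X in _ + X]zero ?addr0//; [by rewrite (le_trans k1)|by rewrite ltW// (lt_trans b1q)|by left; right].
  have e2 : contour P Q (p - eta) (p + eta) b1 b2 =
            contour P Q (p - eta) (p + eta) (q - eta) (q + eta).
    rewrite (Gt (p - eta) (p + eta) b1 b2 (q - eta))//; last by rewrite (le_trans k10).
    rewrite zero ?add0r//; [|by rewrite (le_trans k10)|by right; left].
    rewrite (Gt (p - eta) (p + eta) (q - eta) b2 (q + eta))//.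
    rewrite [X in _ + X]zero ?addr0//; [by rewrite (le_trans k3)|by right; right].
  rewrite e1 e2.
  apply: le_trans (@contour_bound _ P Q a1 a2 b1 b2 _ _ _ _ M cP cQ k1 k9 k2 k3 k10 k4 _) _.
    move=> x y /andP[x1 x2] /andP[y1 y2].
    have xp : `|x - p| <= eta by rewrite ler_distl; apply/andP.
    have yq : `|y - q| <= eta by rewrite ler_distl; apply/andP.
    have DP := D1 x y (le_trans xp ed1) (le_trans yq ed1).
    have DQ := D2 x y (le_trans xp ed2) (le_trans yq ed2).
    split; rewrite /M.
    - rewrite -(subrK (P p q) (P x y)) (le_trans (ler_normD _ _))//.
      by have := normr_ge0 (Q p q); clear -DP; lra.
    - rewrite -(subrK (Q p q) (Q x y)) (le_trans (ler_normD _ _))//.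
      by have := normr_ge0 (P p q); clear -DQ; lra.
  by clear; nra.
apply/eqP; rewrite -normr_eq0 eq_le normr_ge0 andbT; apply/ler_addgt0Pl => e e0.
rewrite addr0; pose eta := Num.min m (e / (8 * M)).
have eta0 : 0 < eta by rewrite lt_min m0 divr_gt0// mulr_gt0.
apply: le_trans (bnd eta eta0 _) _; first by rewrite ge_min lexx.
by rewrite mulrC -ler_pdivlMr ?mulr_gt0// ge_min lexx orbT.
Qed.

End removable_point.

(** * The chart [exp (u + i t)] and holomorphy in its coordinates *)

Section exponential_coordinates.
Context {R : realType}.
Implicit Types (f : cplx R -> cplx R) (z w D A B : cplx R) (G H : R -> R -> cplx R).

(** The complex exponential of [u + i t]. *)
Definition cE (u t : R) : cplx R := (expR u * cos t +i* (expR u * sin t))%C.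

Lemma cE0 : cE 0 0 = 1.
Proof. by apply/eqP; rewrite eq_complex/= expR0 cos0 sin0 mulr0 mulr1 !eqxx. Qed.

Lemma cED u t h k : cE (u + h) (t + k) = cE u t * cE h k.
Proof.
by apply/eqP; rewrite eq_complex/= expRD cosD sinD; apply/andP; split; apply/eqP; ring.
Qed.

Lemma cabs_cE u t : cabs (cE u t) = expR u.
Proof.
by rewrite /cabs/= !exprMn -mulrDr cos2Dsin2 mulr1 sqrtr_sqr ger0_norm//.
Qed.

Lemma cE_neq0 u t : cE u t != 0.
Proof. by rewrite -cabs_gt0 cabs_cE expR_gt0. Qed.

Lemma cE_pi u : cE u (- pi) = cE u pi.
Proof. by rewrite /cE cosN sinN sinpi oppr0. Qed.

(** The increment is read as the complex number [(x - u) + i (y - t)] and multiplied by [D]: this is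
    holomorphy of [G] in [u + i t]. Real and imaginary parts of [D] then yield the Cauchy-Riemann
    equations. *)
Definition zdiff G (u t : R) D := forall e : R, 0 < e -> exists2 d : R, 0 < d &
  forall x y, `|x - u| <= d -> `|y - t| <= d ->
    cabs (G x y - G u t - D * ((x - u) +i* (y - t))%C) <= e * (`|x - u| + `|y - t|).

Lemma zdiff_Re G u t D : zdiff G u t D ->
  rdiff (fun x y => complex.Re (G x y)) u t (complex.Re D) (- complex.Im D).
Proof.
move=> dG e /dG[d d0 dGe]; exists d => // x y xd yd.
apply: le_trans (dGe x y xd yd); apply: le_trans (Re_le_cabs _).
rewrite le_eqVlt; apply/orP; left; apply/eqP; congr `|_|.
by case: (G x y) (G u t) D {dG dGe} => [a b] [a' b'] [p q] /=; ring.
Qed.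

Lemma zdiff_Im G u t D : zdiff G u t D ->
  rdiff (fun x y => complex.Im (G x y)) u t (complex.Im D) (complex.Re D).
Proof.
move=> dG e /dG[d d0 dGe]; exists d => // x y xd yd.
apply: le_trans (dGe x y xd yd); apply: le_trans (Im_le_cabs _).
rewrite le_eqVlt; apply/orP; left; apply/eqP; congr `|_|.
by case: (G x y) (G u t) D {dG dGe} => [a b] [a' b'] [p q] /=; ring.
Qed.

Lemma rdiffN (P : R -> R -> R) u t a b : rdiff P u t a b ->
  rdiff (fun x y => - P x y) u t (- a) (- b).
Proof.
move=> dP e /dP[d d0 dPe]; exists d => // x y xd yd.
rewrite -normrN; apply: le_trans (dPe x y xd yd).
by rewrite le_eqVlt; apply/orP; left; apply/eqP; congr `|_|; ring.
Qed.

Lemma cabs_step (h k : R) : cabs ((h +i* k)%C : cplx R) <= `|h| + `|k|.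
Proof. exact: cabs_le. Qed.

Lemma zdiff_lipschitz G u t D : zdiff G u t D -> exists2 d : R, 0 < d &
  forall x y, `|x - u| <= d -> `|y - t| <= d ->
    cabs (G x y - G u t) <= (cabs D + 1) * (`|x - u| + `|y - t|).
Proof.
move=> /(_ 1 ltr01)[d d0 dG]; exists d => // x y xd yd.
rewrite -(subrK (D * ((x - u) +i* (y - t))%C) (G x y - G u t)).
apply: le_trans (cabsD _ _) _; rewrite mulrDl [leRHS]addrC.
apply: lerD; first exact: dG.
by rewrite cabsM; apply: ler_wpM2l => //; exact: cabs_step.
Qed.

(** Chain rule: half of the tolerance pays for the error of [f], through the Lipschitz bound on [G],
    and half for the error of [G] multiplied by [D]. *)
Lemma zdiff_comp f G u t A D : cdiff f (G u t) D -> zdiff G u t A ->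
  zdiff (fun x y => f (G x y)) u t (D * A).
Proof.
move=> df dG e e0.
have A0 : 0 < cabs A + 1 by rewrite ltr_wpDl.
have D0 : 0 < cabs D + 1 by rewrite ltr_wpDl.
have [d1 d10 L] := zdiff_lipschitz dG.
have [d2 d20 F] := df (e / 2 / (cabs A + 1)) ltac:(by rewrite !divr_gt0).
have [d3 d30 K] := dG (e / 2 / (cabs D + 1)) ltac:(by rewrite !divr_gt0).
pose d := Num.min (Num.min d1 d3) (d2 / (2 * (cabs A + 1))).
exists d => [|x y]; first by rewrite !lt_min d10 d30 divr_gt0// mulr_gt0.
rewrite /d !le_min => /andP[/andP[xd1 xd3] xd2] /andP[/andP[yd1 yd3] yd2].
set N := `|x - u| + `|y - t|.
have N0 : 0 <= N by rewrite addr_ge0.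
have hL := L x y xd1 yd1; rewrite -/N in hL.
have Nd2 : (cabs A + 1) * N <= d2.
  rewrite mulrC -ler_pdivlMr//.
  have -> : d2 / (cabs A + 1) = d2 / (2 * (cabs A + 1)) + d2 / (2 * (cabs A + 1)).
    by field; rewrite gt_eqF.
  by rewrite lerD.
have hF := F _ (le_trans hL Nd2).
have hK := K x y xd3 yd3; rewrite -/N in hK.
rewrite (_ : _ - _ - _ = (f (G x y) - f (G u t) - D * (G x y - G u t)) +
  D * (G x y - G u t - A * ((x - u) +i* (y - t))%C)); last by ring.
rewrite (le_trans (cabsD _ _))// cabsM.
have -> : e * N = e / 2 * N + e / 2 * N by field.
rewrite lerD//.
- apply: (le_trans hF); rewrite -mulrA ler_pM2l ?divr_gt0//.
  by rewrite ler_pdivrMl.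
- apply: le_trans (_ : cabs D * (e / 2 / (cabs D + 1) * N) <= _); first by rewrite ler_wpM2l.
  rewrite mulrA ler_wpM2r// mulrCA -[leRHS]mulr1 ler_wpM2l ?divr_ge0 ?(ltW e0)//.
  by rewrite ler_pdivrMr// mul1r lerDl.
Qed.

Lemma zdiff_mul G H u t A B : zdiff G u t A -> zdiff H u t B ->
  zdiff (fun x y => G x y * H x y) u t (A * H u t + G u t * B).
Proof.
move=> dG dH e e0.
have G0 : 0 < cabs (G u t) + 1 by rewrite ltr_wpDl.
have H0 : 0 < cabs (H u t) + 1 by rewrite ltr_wpDl.
have A0 : 0 < cabs A + 1 by rewrite ltr_wpDl.
have B0 : 0 < cabs B + 1 by rewrite ltr_wpDl.
have [d1 d10 L1] := zdiff_lipschitz dG; have [d2 d20 L2] := zdiff_lipschitz dH.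
have [d3 d30 K1] := dG (e / 3 / (cabs (H u t) + 1)) ltac:(by rewrite !divr_gt0).
have [d4 d40 K2] := dH (e / 3 / (cabs (G u t) + 1)) ltac:(by rewrite !divr_gt0).
(* Controls the product of the two increments, which is at most
   [(cabs A + 1) * (cabs B + 1) * N ^+ 2], through [N <= 2 * d5]. *)
pose d5 := e / 3 / (2 * ((cabs A + 1) * (cabs B + 1))).
have d50 : 0 < d5 by rewrite !divr_gt0// !mulr_gt0.
exists (Num.min (Num.min (Num.min d1 d2) (Num.min d3 d4)) d5) => [|x y].
  by rewrite !lt_min d10 d20 d30 d40.
rewrite !le_min => /andP[/andP[/andP[x1 x2] /andP[x3 x4]] x5].
move=> /andP[/andP[/andP[y1 y2] /andP[y3 y4]] y5].
set N := `|x - u| + `|y - t|.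
have N0 : 0 <= N by rewrite addr_ge0.
have Nd5 : N <= 2 * d5 by rewrite /N; clear -x5 y5; lra.
have {}L1 := L1 x y x1 y1; have {}L2 := L2 x y x2 y2.
have {}K1 := K1 x y x3 y3; have {}K2 := K2 x y x4 y4.
rewrite -/N in L1 L2 K1 K2.
set s := (_ +i* _)%C in K1 K2 *.
rewrite (_ : _ - _ - _ = (G x y - G u t - A * s) * H u t +
  G u t * (H x y - H u t - B * s) + (G x y - G u t) * (H x y - H u t)); last by ring.
rewrite (le_trans (cabsD _ _))//.
have -> : e * N = e / 3 * N + e / 3 * N + e / 3 * N by field.
have absorb (c n : R) : 0 <= c -> n <= e / 3 / (c + 1) * N -> n * c <= e / 3 * N.
  move=> c0 hn; have c1 : 0 < c + 1 by rewrite ltr_wpDl.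
  apply: le_trans (_ : e / 3 / (c + 1) * N * c <= _); first by rewrite ler_wpM2r.
  rewrite mulrAC; apply: ler_wpM2r => //.
  rewrite mulrAC ler_pdivrMr//; apply: ler_wpM2l; last by rewrite lerDl.
  by rewrite divr_ge0 ?(ltW e0).
rewrite lerD//.
- rewrite (le_trans (cabsD _ _))// !cabsM lerD//; first exact: absorb.
  by rewrite mulrC; exact: absorb.
- rewrite cabsM; apply: le_trans (ler_pM _ _ L1 L2) _ => //.
  rewrite mulrACA mulrA ler_wpM2r// mulrC -ler_pdivlMr ?mulr_gt0//.
  apply: (le_trans Nd5); rewrite /d5 le_eqVlt; apply/orP; left; apply/eqP.
  by field; rewrite !gt_eqF.
Qed.

Lemma is_derive_littleo (f : R -> R) (x l : R) : is_derive x 1 f l ->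
  forall e : R, 0 < e -> exists2 d : R, 0 < d & forall h, `|h| <= d ->
    `|f (x + h) - f x - l * h| <= e * `|h|.
Proof.
move=> [/cvg_ex[/= l' fl'] ll'] e e0.
have ll : l' = l by rewrite -ll'; apply/esym/cvg_lim.
move: fl'; rewrite {}ll => /cvgrPdist_le/(_ _ e0).
rewrite near_withinE => /nbhs_ballP[d /= d0 dD]; exists (d / 2) => [|h hd].
  by rewrite divr_gt0.
have [->|h0] := eqVneq h 0; first by rewrite addr0 subrr mulr0 subr0 normr0 mulr0.
have bh : ball (0 : R) d h.
  rewrite -ball_normE /ball_/= sub0r normrN (le_lt_trans hd)//.
  by rewrite ltr_pdivrMr// ltr_pMr// ltr1n.
have := dD h bh h0; rewrite /GRing.scale/= mulr1 [h + x]addrC => le_e.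
rewrite (_ : f (x + h) - f x - l * h = - ((l - h^-1 * (f (x + h) - f x)) * h)).
  by rewrite normrN normrM ler_wpM2r.
by rewrite mulrBl mulrAC mulVf// mul1r opprB.
Qed.

Lemma zdiff_cE00 : zdiff cE 0 0 1.
Proof.
move=> e e0; have e6 : 0 < e / 6 by rewrite divr_gt0.
have [d1 d10 X] := is_derive_littleo (is_derive_expR (0 : R)) e6.
have [d2 d20 C] := is_derive_littleo (is_derive_cos (0 : R)) e6.
have [d3 d30 S] := is_derive_littleo (is_derive_sin (0 : R)) e6.
have [d4 d40 X1] := is_derive_littleo (is_derive_expR (0 : R)) (@ltr01 R).
(* The first bound gives [expR h - 1] modulus at most [e / 6], the second gives [expR h] at most
   2. *)
pose d5 : R := Num.min (e / 12) (2^-1).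
have d50 : 0 < d5 by rewrite lt_min invr_gt0 divr_gt0// ltr0n.
exists (Num.min (Num.min (Num.min d1 d2) (Num.min d3 d4)) d5) => [|h k].
  by rewrite !lt_min d10 d20 d30 d40 divr_gt0//= invr_gt0 ltr0n.
rewrite !subr0 !le_min => /andP[/andP[/andP[h1 h2] /andP[h3 h4]] /andP[h5 h6]].
move=> /andP[/andP[/andP[k1 k2] /andP[k3 k4]] /andP[k5 k6]].
move: (X h h1) (C k k2) (S k k3) (X1 h h4).
rewrite !add0r expR0 cos0 sin0 !subr0 !mul1r oppr0 mul0r subr0 => {}X {}C {}S {}X1.
have E1 : `|expR h - 1| <= 2 * `|h|.
  have := ler_normD (expR h - 1 - h) h; rewrite subrK => /le_trans; apply.
  by clear -X1; lra.
have E2 : `|expR h| <= 2.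
  by have := ler_normD (expR h - 1) 1; rewrite subrK normr1; clear -E1 h6; lra.
rewrite cE0 (le_trans (cabs_le _))//=.
rewrite subr0.
have C1 : `|expR h * cos k - 1 - h| <= e / 6 * `|h| + 2 * (e / 6 * `|k|).
  rewrite (_ : _ - _ = (expR h - 1 - h) + expR h * (cos k - 1)); last by ring.
  by rewrite (le_trans (ler_normD _ _))// lerD// normrM ler_pM.
have C2 : `|expR h * sin k - k| <= 2 * (e / 6 * `|k|) + e / 6 * `|k|.
  rewrite (_ : _ - _ = expR h * (sin k - k) + (expR h - 1) * k); last by ring.
  rewrite (le_trans (ler_normD _ _))// !normrM lerD//; first by rewrite ler_pM.
  by apply: ler_wpM2r => //; apply: (le_trans E1); clear -h5; lra.
have h0 : 0 <= e * `|h| by rewrite mulr_ge0// ltW.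
have k0 : 0 <= e * `|k| by rewrite mulr_ge0// ltW.
by clear -C1 C2 h0 k0; lra.
Qed.

(** Multiplicativity of the exponential moves the point to the origin; the error is scaled by the
    modulus [expR u], hence the tolerance [e / expR u] there. *)
Lemma zdiff_cE u t : zdiff cE u t (cE u t).
Proof.
move=> e e0; have E0 : 0 < expR u by exact: expR_gt0.
have [d d0 K] := zdiff_cE00 (divr_gt0 e0 E0).
exists d => // x y xd yd; have := K (x - u) (y - t).
rewrite !subr0 => /(_ xd yd); rewrite cE0 => {}K.
have -> : cE x y = cE u t * cE (x - u) (y - t) by rewrite -cED ![_ + (_ - _)]addrC !subrK.
rewrite (_ : _ - _ - _ = cE u t * (cE (x - u) (y - t) - 1 - 1 * ((x - u) +i* (y - t))%C));
  last by ring.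
by rewrite cabsM cabs_cE mulrC -ler_pdivlMr// mulrAC.
Qed.

End exponential_coordinates.

(** * Integrals of complex functions over a segment *)

Section complex_integrals.
Context {R : realType}.
Implicit Types (a b : R) (g h : R -> cplx R).

Definition ccts a b g := cts a b (fun t => complex.Re (g t)) /\ cts a b (fun t => complex.Im (g t)).

Definition cint a b g : cplx R :=
  (rint a b (fun t => complex.Re (g t)) +i* rint a b (fun t => complex.Im (g t)))%C.

Lemma eq_cint a b g h : (forall t, a <= t <= b -> g t = h t) -> cint a b g = cint a b h.
Proof. by move=> gh; congr (_ +i* _)%C; apply: eq_rint => t /gh ->. Qed.

Lemma ReM (z w : cplx R) :
  complex.Re (z * w) = complex.Re z * complex.Re w - complex.Im z * complex.Im w.
Proof. by case: z w => [a b] [c d]. Qed.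

Lemma ImM (z w : cplx R) :
  complex.Im (z * w) = complex.Re z * complex.Im w + complex.Im z * complex.Re w.
Proof. by case: z w => [a b] [c d]. Qed.

Lemma ReD (z w : cplx R) : complex.Re (z + w) = complex.Re z + complex.Re w.
Proof. by case: z w => [a b] [c d]. Qed.

Lemma ImD (z w : cplx R) : complex.Im (z + w) = complex.Im z + complex.Im w.
Proof. by case: z w => [a b] [c d]. Qed.

Lemma cctsM a b g h : ccts a b g -> ccts a b h -> ccts a b (fun t => g t * h t).
Proof.
move=> [g1 g2] [h1 h2]; split.
- rewrite (_ : (fun t => _) = fun t => complex.Re (g t) * complex.Re (h t) +
    - (complex.Im (g t) * complex.Im (h t))); last by apply/funext => t; exact: ReM.
  by apply: ctsD; [exact: ctsM|apply: ctsN; exact: ctsM].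
- rewrite (_ : (fun t => _) = fun t => complex.Re (g t) * complex.Im (h t) +
    complex.Im (g t) * complex.Re (h t)); last by apply/funext => t; exact: ImM.
  by apply: ctsD; exact: ctsM.
Qed.

Lemma ccts_cst a b z : ccts a b (fun=> z).
Proof. by split; exact: cts_cst. Qed.

Lemma cintD a b g h : ccts a b g -> ccts a b h ->
  cint a b (fun t => g t + h t) = cint a b g + cint a b h.
Proof.
move=> [g1 g2] [h1 h2]; apply/eqP; rewrite eq_complex/=; apply/andP; split; apply/eqP.
- by rewrite -rintD//; apply: eq_rint => t _; exact: ReD.
- by rewrite -rintD//; apply: eq_rint => t _; exact: ImD.
Qed.

Lemma cintZ a b z g : ccts a b g -> cint a b (fun t => z * g t) = z * cint a b g.
Proof.
move=> [g1 g2]; apply/eqP; rewrite eq_complex ReM ImM /=; apply/andP; split; apply/eqP.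
- rewrite -!rintZ// -rintB; [|by apply: ctsM => //; exact: cts_cst..].
  by apply: eq_rint => t _; exact: ReM.
- rewrite -!rintZ// -rintD; [|by apply: ctsM => //; exact: cts_cst..].
  by apply: eq_rint => t _; exact: ImM.
Qed.

Lemma cint_cst a b z : a <= b -> cint a b (fun=> z) = z * (b - a)%:C%C.
Proof.
move=> ab; apply/eqP; rewrite eq_complex ReM ImM/= !rint_cst//.
by rewrite !mulr0 subr0 add0r !eqxx.
Qed.

Lemma cts_cabs a b g : ccts a b g -> cts a b (fun t => cabs (g t)).
Proof.
move=> [g1 g2] x xab.
rewrite (_ : (fun t => _) = fun t =>
   Num.sqrt (complex.Re (g t) ^+ 2 + complex.Im (g t) ^+ 2)); last first.
  by apply/funext => t; case: (g t).
apply: (@continuous_comp _ _ _ (fun t => complex.Re (g t) ^+ 2 + complex.Im (g t) ^+ 2) Num.sqrt).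
  by move: x xab; apply: ctsD; apply: ctsM.
exact: sqrt_continuous.
Qed.

Lemma cabs_conj (z : cplx R) : cabs (z^*)%C = cabs z.
Proof. by case: z => a b; rewrite /cabs/= sqrrN. Qed.

Lemma rint_ge0 a b (f : R -> R) : (forall t, a <= t <= b -> 0 <= f t) -> 0 <= rint a b f.
Proof. by move=> f0; apply: Rintegral_ge0 => t /=; rewrite in_itv/=; exact: f0. Qed.

(** Multiplying by the conjugate [J] of the integral [I] turns it onto the real axis: [|I|^2] is the
    integral of the real part of [J g], hence at most [|I|] times the integral of [|g|]. *)
Lemma cabs_cint_le a b g : ccts a b g -> cabs (cint a b g) <= rint a b (fun t => cabs (g t)).
Proof.
move=> cg; have [g1 g2] := cg; set I := cint a b g.
have [I0|I0] := eqVneq (cabs I) 0; first by rewrite I0 rint_ge0.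
have Ipos : 0 < cabs I by rewrite lt_def I0 cabs_ge0.
rewrite -(ler_pM2l Ipos) -expr2 cabs_sqr -rintZ; last exact: cts_cabs.
pose J : cplx R := (I^*)%C; have JI : cabs J = cabs I by exact: cabs_conj.
rewrite (_ : _ + _ = complex.Re (J * I)); last first.
  by rewrite ReM /J; case: (I) => c d /=; ring.
rewrite {2}/I -cintZ// /cint/=; apply: rint_le.
- by have [] := cctsM (ccts_cst a b J) cg.
- by apply: ctsM; [exact: cts_cst|exact: cts_cabs].
- move=> t _; apply: (le_trans (ler_norm _)); apply: le_trans (Re_le_cabs _) _.
  by rewrite cabsM JI.
Qed.

(** Cauchy-Schwarz against the constant 1, obtained by expanding the variance, the integral of
    [(f - m)^2] with [m] the mean of [f]. *)
Lemma rint_sqr_le a b (f : R -> R) : a < b -> cts a b f ->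
  rint a b f ^+ 2 <= (b - a) * rint a b (fun t => f t ^+ 2).
Proof.
move=> ab cf; have ba : 0 < b - a by rewrite subr_gt0.
pose m := rint a b f / (b - a).
have c2 : cts a b (fun t => f t ^+ 2) by exact: ctsM.
have cm : cts a b (fun t => (- 2 * m) * f t) by apply: ctsM => //; exact: cts_cst.
have : 0 <= rint a b (fun t => (f t ^+ 2 + (- 2 * m) * f t) + m ^+ 2).
  apply: rint_ge0 => t _; rewrite (_ : _ + _ = (f t - m) ^+ 2) ?sqr_ge0//; ring.
rewrite rintD; [|exact: ctsD|exact: cts_cst].
rewrite rintD// rintZ// rint_cst ?(ltW ab)// => h.
have mE : m * (b - a) = rint a b f by rewrite /m divfK// gt_eqF.
have h2 := mulr_ge0 (ltW ba) h; rewrite -mE in h2.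
rewrite -subr_ge0 -mE; apply: (le_trans h2); rewrite le_eqVlt; apply/orP; left; apply/eqP.
by ring.
Qed.

Lemma cabs_cint_mul_le a b g h (k : R) : a < b -> 0 <= k -> ccts a b g -> ccts a b h ->
  (forall t, a <= t <= b -> cabs (h t) <= k) ->
  cabs (cint a b (fun t => g t * h t)) <=
    k * Num.sqrt ((b - a) * rint a b (fun t => cabs (g t) ^+ 2)).
Proof.
move=> ab k0 cg ch hk; have cag := cts_cabs cg.
apply: le_trans (cabs_cint_le (cctsM cg ch)) _.
apply: le_trans (_ : k * rint a b (fun t => cabs (g t)) <= _).
  rewrite -rintZ//; apply: rint_le.
  - exact/cts_cabs/cctsM.
  - by apply: ctsM => //; exact: cts_cst.
  - by move=> t /hk ?; rewrite cabsM mulrC ler_wpM2r.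
apply: ler_wpM2l => //; rewrite -[leLHS]ger0_norm ?rint_ge0// -sqrtr_sqr.
by rewrite ler_wsqrtr// rint_sqr_le.
Qed.

End complex_integrals.

(** * Integrals over concentric circles and their dependence on the radius *)

Section circle_integrals.
Context {R : realType}.
Implicit Types (F : cplx R -> cplx R) (a z w D : cplx R) (u t : R).

Definition circ_fun F a u t : cplx R := F (a + cE u t) * cE u t.

(* [circ F a u] is 1/i times the integral of F dz over the circle of centre a and radius exp u. *)
Definition circ F a u : cplx R := cint (- pi) pi (circ_fun F a u).

Lemma npi_le_pi : - pi <= pi :> R.
Proof. by have := pi_gt0 R; lra. Qed.

Definition ccont F z := forall e : R, 0 < e -> exists2 d : R, 0 < d &
  forall w, cabs (w - z) <= d -> cabs (F w - F z) <= e.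

Lemma cdiff_ccont F z D : cdiff F z D -> ccont F z.
Proof.
move=> /(_ 1 ltr01)[d d0 dF] e e0.
have D0 : 0 < cabs D + 1 by rewrite ltr_wpDl.
exists (Num.min d (e / (cabs D + 1))) => [|w]; first by rewrite lt_min d0 divr_gt0.
rewrite le_min => /andP[wd we]; have := dF w wd; rewrite mul1r => h.
rewrite -(subrK (D * (w - z)) (F w - F z)); apply: le_trans (cabsD _ _) _.
rewrite cabsM; apply: le_trans (lerD h (lexx _)) _.
by move: we; rewrite ler_pdivlMr//; clear; lra.
Qed.

Definition zcont (G : R -> R -> cplx R) u t := forall e : R, 0 < e -> exists2 d : R, 0 < d &
  forall x y, `|x - u| <= d -> `|y - t| <= d -> cabs (G x y - G u t) <= e.

Lemma zcont_Re G u t : zcont G u t -> rcont (fun x y => complex.Re (G x y)) u t.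
Proof.
move=> cG e /cG[d d0 dG]; exists d => // x y xd yd.
apply: le_trans (dG x y xd yd); apply: le_trans (Re_le_cabs _).
by case: (G x y) (G u t) => [? ?] [? ?].
Qed.

Lemma zcont_Im G u t : zcont G u t -> rcont (fun x y => complex.Im (G x y)) u t.
Proof.
move=> cG e /cG[d d0 dG]; exists d => // x y xd yd.
apply: le_trans (dG x y xd yd); apply: le_trans (Im_le_cabs _).
by case: (G x y) (G u t) => [? ?] [? ?].
Qed.

Lemma rcontN (P : R -> R -> R) u t : rcont P u t -> rcont (fun x y => - P x y) u t.
Proof.
move=> cP e /cP[d d0 dP]; exists d => // x y xd yd.
by rewrite -opprD normrN dP.
Qed.

Lemma zdiff_pol a u t : zdiff (fun x y => a + cE x y) u t (cE u t).
Proof.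
move=> e /(zdiff_cE u t)[d d0 dE]; exists d => // x y xd yd.
by rewrite (_ : a + cE x y - (a + cE u t) = cE x y - cE u t); [exact: dE|ring].
Qed.

Lemma zcont_comp F G u t D : ccont F (G u t) -> zdiff G u t D -> zcont (fun x y => F (G x y)) u t.
Proof.
move=> cF /zdiff_lipschitz[d1 d10 L] e /cF[d2 d20 dF].
have D0 : 0 < cabs D + 1 by rewrite ltr_wpDl.
exists (Num.min d1 (d2 / (2 * (cabs D + 1)))) => [|x y].
  by rewrite lt_min d10 divr_gt0// mulr_gt0.
rewrite !le_min => /andP[x1 x2] /andP[y1 y2]; apply: dF.
apply: (le_trans (L x y x1 y1)); move: x2 y2.
rewrite !ler_pdivlMr ?mulr_gt0//; clear; lra.
Qed.

Lemma zcont_mul G H u t : zcont G u t -> zcont H u t -> zcont (fun x y => G x y * H x y) u t.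
Proof.
move=> cG cH e e0.
have G0 : 0 < cabs (G u t) + 1 by rewrite ltr_wpDl.
have H0 : 0 < cabs (H u t) + 1 by rewrite ltr_wpDl.
have [d1 d10 K1] := cH 1 ltr01.
have [d2 d20 K2] := cG (e / 2 / (cabs (H u t) + 1)) ltac:(by rewrite !divr_gt0).
have [d3 d30 K3] := cH (e / 2 / (cabs (G u t) + 1)) ltac:(by rewrite !divr_gt0).
exists (Num.min (Num.min d1 d2) d3) => [|x y]; first by rewrite !lt_min d10 d20.
rewrite !le_min => /andP[/andP[x1 x2] x3] /andP[/andP[y1 y2] y3].
have {}K1 := K1 x y x1 y1; have {}K2 := K2 x y x2 y2; have {}K3 := K3 x y x3 y3.
have HE : cabs (H x y) <= cabs (H u t) + 1.
  by rewrite -(subrK (H u t) (H x y)) (le_trans (cabsD _ _))// addrC lerD2l.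
rewrite (_ : _ - _ = (G x y - G u t) * H x y + G u t * (H x y - H u t)); last by ring.
apply: le_trans (cabsD _ _) _; rewrite !cabsM.
have -> : e = e / 2 / (cabs (H u t) + 1) * (cabs (H u t) + 1) +
   (cabs (G u t) + 1) * (e / 2 / (cabs (G u t) + 1)) by field; rewrite !gt_eqF.
by apply: lerD; apply: ler_pM => //; rewrite lerDl.
Qed.

Lemma circ_zcont F a u t : ccont F (a + cE u t) -> zcont (circ_fun F a) u t.
Proof.
move=> cF; apply: zcont_mul; first exact: (zcont_comp cF (zdiff_pol a u t)).
apply: (@zcont_comp id _ _ _ _ _ (zdiff_cE u t)) => e e0; by exists e.
Qed.

Lemma circ_zdiff F a u t D : cdiff F (a + cE u t) D -> exists A, zdiff (circ_fun F a) u t A.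
Proof.
by move=> dF; eexists; apply: zdiff_mul (zdiff_comp dF (zdiff_pol a u t)) (zdiff_cE u t).
Qed.

Lemma circ_ccts F a u : (forall t, - pi <= t <= pi -> ccont F (a + cE u t)) ->
  ccts (- pi) pi (circ_fun F a u).
Proof.
move=> cF; split => t ht.
- exact: (@rcont_cont2 _ (fun x y => complex.Re (circ_fun F a x y))) (zcont_Re (circ_zcont (cF t ht))).
- exact: (@rcont_cont2 _ (fun x y => complex.Im (circ_fun F a x y))) (zcont_Im (circ_zcont (cF t ht))).
Qed.

(** The sides at angles [- pi] and [pi] carry the same integral with opposite signs, so a vanishing
    contour equates the two remaining sides, which are full circles. *)
Lemma contour_periodic (P Q : R -> R -> R) u1 u2 : (forall u, P u (- pi) = P u pi) ->
  contour P Q u1 u2 (- pi) pi = 0 -> rint (- pi) pi (Q u1) = rint (- pi) pi (Q u2).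
Proof.
move=> Pper; rewrite /contour (@eq_rint _ u1 u2 (P ^~ (- pi)) (P ^~ pi)) => [|x _ //].
by rewrite subrr add0r => /eqP; rewrite subr_eq0 => /eqP.
Qed.

Lemma circ_fun_per F a u : circ_fun F a u (- pi) = circ_fun F a u pi.
Proof. by rewrite /circ_fun !cE_pi. Qed.

Let oppK (f : R -> R) (x y : R) : cts x y f -> rint x y (fun t => - f t) = - rint x y f.
Proof.
move=> cf; rewrite -mulN1r -rintZ//; apply: eq_rint => t _; by rewrite mulN1r.
Qed.

(** The two forms are the real and imaginary parts of [G dw] with [w = u + i t] and [G] the circle
    integrand: [Re G du - Im G dt] and [Im G du + Re G dt]. *)
Lemma circ_eq_of_contours F a u1 u2 :
  (forall t, - pi <= t <= pi -> ccont F (a + cE u1 t)) ->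
  (forall t, - pi <= t <= pi -> ccont F (a + cE u2 t)) ->
  contour (fun u t => complex.Re (circ_fun F a u t)) (fun u t => - complex.Im (circ_fun F a u t))
    u1 u2 (- pi) pi = 0 ->
  contour (fun u t => complex.Im (circ_fun F a u t)) (fun u t => complex.Re (circ_fun F a u t))
    u1 u2 (- pi) pi = 0 ->
  circ F a u1 = circ F a u2.
Proof.
move=> c1 c2 /contour_periodic h1 /contour_periodic h2.
have [_ i1] := circ_ccts c1; have [_ i2] := circ_ccts c2.
apply/eqP; rewrite eq_complex/=; apply/andP; split; apply/eqP.
- by apply: h2 => u; rewrite circ_fun_per.
- by apply: oppr_inj; rewrite -(oppK i1) -(oppK i2); apply: h1 => u; rewrite circ_fun_per.
Qed.

Lemma circ_indep F a u1 u2 : u1 <= u2 ->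
  (forall u t, u1 <= u <= u2 -> exists D, cdiff F (a + cE u t) D) ->
  circ F a u1 = circ F a u2.
Proof.
move=> u12 dF.
have cF u t : u1 <= u <= u2 -> ccont F (a + cE u t).
  by move=> /(dF u t)[D /cdiff_ccont].
apply: circ_eq_of_contours.
- by move=> t _; apply: cF; rewrite lexx.
- by move=> t _; apply: cF; rewrite lexx andbT.
- apply: goursat => //; first exact: npi_le_pi.
  move=> u t hu _; have [D /circ_zdiff[A dA]] := dF u t hu.
  exists (complex.Re A), (- complex.Im A), (- complex.Re A).
  by split; [exact: zdiff_Re|apply: rdiffN; exact: zdiff_Im].
- apply: goursat => //; first exact: npi_le_pi.
  move=> u t hu _; have [D /circ_zdiff[A dA]] := dF u t hu.
  exists (complex.Im A), (complex.Re A), (- complex.Im A).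
  by split; [exact: zdiff_Im|exact: zdiff_Re].
Qed.

(** The exceptional point lies on the ray of angle 0, so its coordinates [(p, 0)] are interior to
    the rectangle, as [goursat_except] requires. *)
Lemma circ_indep_except F a u1 p u2 : u1 < p < u2 ->
  ccont F (a + cE p 0) ->
  (forall u t, u1 <= u <= u2 -> - pi <= t <= pi -> (u, t) != (p, 0) ->
     exists D, cdiff F (a + cE u t) D) ->
  circ F a u1 = circ F a u2.
Proof.
move=> /andP[u1p pu2] c0 dF.
have cF u t : u1 <= u <= u2 -> - pi <= t <= pi -> ccont F (a + cE u t).
  move=> hu ht; have [[-> ->]//|ut] := eqVneq (u, t) (p, 0).
  by have [D /cdiff_ccont] := dF u t hu ht ut.
have pi0 := pi_gt0 R; have npi : - pi < 0 :> R by rewrite oppr_lt0.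
have u12 : u1 <= u2 by rewrite ltW// (lt_trans u1p).
have cRe : rect_cont (fun u t => complex.Re (circ_fun F a u t)) u1 u2 (- pi) pi.
  by move=> u t hu ht; apply: zcont_Re; apply: circ_zcont; exact: cF.
have cIm : rect_cont (fun u t => complex.Im (circ_fun F a u t)) u1 u2 (- pi) pi.
  by move=> u t hu ht; apply: zcont_Im; apply: circ_zcont; exact: cF.
apply: circ_eq_of_contours.
- by move=> t; apply: cF; rewrite lexx.
- by move=> t; apply: cF; rewrite lexx andbT.
- apply: (goursat_except u1p pu2 npi pi0) => //.
    by move=> u t hu ht; apply: rcontN; exact: cIm.
  move=> u t hu ht ut; have [D /circ_zdiff[A dA]] := dF u t hu ht ut.
  exists (complex.Re A), (- complex.Im A), (- complex.Re A).
  by split; [exact: zdiff_Re|apply: rdiffN; exact: zdiff_Im].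
- apply: (goursat_except u1p pu2 npi pi0) => //.
  move=> u t hu ht ut; have [D /circ_zdiff[A dA]] := dF u t hu ht ut.
  exists (complex.Im A), (complex.Re A), (- complex.Im A).
  by split; [exact: zdiff_Im|exact: zdiff_Re].
Qed.

Lemma derivable_inv_sub (z0 w : cplx R) : w != z0 ->
  derivable (fun x : cplx R => (x - z0)^-1) w 1.
Proof.
move=> wz; apply: (@derivableV _ _ (fun x : cplx R => x - z0)).
  by rewrite subr_eq0.
by apply: derivableB; [exact: derivable_id|exact: derivable_cst].
Qed.

Lemma cdiff_inv_sub (z0 w : cplx R) : w != z0 -> exists D, cdiff (fun x => (x - z0)^-1) w D.
Proof. by move=> /derivable_inv_sub/derivable_cdiff. Qed.

Lemma cabs_circ_le F a u (k : R) : (forall t, - pi <= t <= pi -> ccont F (a + cE u t)) ->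
  (forall t, cabs (circ_fun F a u t) <= k) -> cabs (circ F a u) <= 2 * pi * k.
Proof.
move=> cF hk; have cg := circ_ccts cF.
apply: le_trans (cabs_cint_le cg) _.
apply: le_trans (_ : rint (- pi) pi (fun=> k) <= _).
  by apply: rint_le; [exact: cts_cabs|exact: cts_cst|move=> t _].
by rewrite rint_cst ?npi_le_pi//; lra.
Qed.

(** Here the circle lies inside the radius of the pole. The integral does not change while the
    circle shrinks to its centre, and it tends to 0 with the radius. *)
Lemma circ_pole_inside a (p u : R) : u < p ->
  circ (fun w => (w - (a + cE p 0))^-1) a u = 0.
Proof.
move=> up; set z0 := a + cE p 0; set F := fun w => _.
have neq v t : v < p -> a + cE v t != z0.
  move=> vp; apply/eqP => /addrI/(congr1 (@cabs R)); rewrite !cabs_cE => /expR_inj vE.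
  by rewrite vE ltxx in vp.
have const v : v <= u -> circ F a u = circ F a v.
  move=> vu; apply/esym/circ_indep => // x t /andP[_ xu].
  by apply/cdiff_inv_sub/neq/(le_lt_trans xu).
have P0 := expR_gt0 p.
apply/eqP; rewrite -cabs_eq0 eq_le cabs_ge0 andbT; apply/ler_addgt0Pl => e e0.
rewrite addr0.
(* radius m = exp v so small that 2 pi m / (exp p - m) <= e *)
pose m := Num.min (expR u) (Num.min (expR p / 2) (e * expR p / (4 * pi))).
have m0 : 0 < m by rewrite !lt_min expR_gt0 !divr_gt0 ?mulr_gt0 ?pi_gt0.
pose v := ln m; have vE : expR v = m by rewrite /v lnK.
have vu : v <= u by rewrite -ler_expR vE /m ge_min lexx.
have vp : v < p by exact: le_lt_trans up.
rewrite (const v vu).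
have mp : m <= expR p / 2 by rewrite /m !ge_min lexx orbT.
have me : m <= e * expR p / (4 * pi) by rewrite /m !ge_min lexx !orbT.
have d0 : 0 < expR p - m by clear -mp P0; lra.
apply: le_trans (cabs_circ_le (k := m / (expR p - m)) _ _) _.
- by move=> t _; have [D /cdiff_ccont] := cdiff_inv_sub (neq v t vp).
- move=> t; rewrite /circ_fun /F cabsM cabsV cabs_cE vE mulrC ler_pM2l//.
  rewrite lef_pV2 ?posrE//; last by rewrite cabs_gt0 subr_eq0 neq.
  rewrite (_ : _ - _ = cE v t - cE p 0); last by rewrite /z0; ring.
  by rewrite cabs_dist; apply: lt_cabs_distD; rewrite cabs_cE ?vE.
- rewrite mulrA ler_pdivrMr//; move: me; rewrite ler_pdivlMr ?mulr_gt0 ?pi_gt0// => me.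
  have : e * (expR p / 2) <= e * (expR p - m) by rewrite ler_pM2l//; clear -mp; lra.
  by clear -me; lra.
Qed.

(** Compare with [1 / (w - a)], whose circle integrand is identically 1 and integrates to [2 * pi].
    The difference [H] decays like the inverse square of the radius, so its integral, independent of
    the radius, is 0. *)
Lemma circ_pole_outside a (p u : R) : p < u ->
  circ (fun w => (w - (a + cE p 0))^-1) a u = (2 * pi)%:C%C.
Proof.
move=> pu; set z0 := a + cE p 0; set F := fun w => _.
have neq v t : p < v -> a + cE v t != z0.
  move=> vp; apply/eqP => /addrI/(congr1 (@cabs R)); rewrite !cabs_cE => /expR_inj vE.
  by rewrite vE ltxx in vp.
have neqa v t : a + cE v t != a by rewrite -subr_eq0 addrC addKr cE_neq0.
have P0 := expR_gt0 p; have U0 := expR_gt0 u.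
pose H w := F w - (w - a)^-1.
have dH v t : p < v -> exists D, cdiff H (a + cE v t) D.
  move=> pv; apply: derivable_cdiff; apply: derivableB.
  - exact/derivable_inv_sub/neq.
  - exact/derivable_inv_sub/neqa.
have cF v t : p < v -> ccont F (a + cE v t).
  by move=> /(neq v t)/cdiff_inv_sub[D /cdiff_ccont].
have Hfun v t : circ_fun H a v t = circ_fun F a v t + (- 1).
  rewrite /circ_fun /H mulrBl; congr (_ - _).
  by rewrite [a + _]addrC addrK mulVf// cE_neq0.
have circH v : p < v -> circ H a v = circ F a v - (2 * pi)%:C%C.
  move=> pv; rewrite /circ (_ : circ_fun H a v = fun t => circ_fun F a v t + (- 1)); last first.
    exact/funext.
  rewrite cintD; last 2 first.
  - by apply: circ_ccts => t _; exact: cF.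
  - exact: ccts_cst.
  rewrite cint_cst ?npi_le_pi// mulN1r; congr (_ - _).
  by rewrite opprK; congr (_%:C)%C; lra.
apply/eqP; rewrite -subr_eq0 -circH//.
rewrite -cabs_eq0 eq_le cabs_ge0 andbT; apply/ler_addgt0Pl => e e0.
rewrite addr0.
(* radius m = exp v so large that 2 pi exp p / (m - exp p) <= e *)
pose m := expR u + expR p + 2 * pi * expR p / e.
have pe0 : 0 < 2 * pi * expR p / e by rewrite divr_gt0// !mulr_gt0// pi_gt0.
have m0 : 0 < m by rewrite /m; clear -U0 P0 pe0; lra.
pose v := ln m; have vE : expR v = m by rewrite /v lnK.
have uv : u <= v by rewrite -ler_expR vE /m; clear -P0 pe0; lra.
have pv : p < v by exact: lt_le_trans uv.
have -> : circ H a u = circ H a v.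
  by apply: circ_indep => // x t /andP[ux _]; apply: dH; exact: lt_le_trans ux.
have d0 : 0 < m - expR p by rewrite /m; clear -U0 pe0; lra.
apply: le_trans (cabs_circ_le (k := expR p / (m - expR p)) _ _) _.
- by move=> t _; have [D /cdiff_ccont] := dH v t pv.
- move=> t; have -> : circ_fun H a v t = cE p 0 * (a + cE v t - z0)^-1.
    rewrite Hfun /circ_fun /F /z0; field.
    have := neq v t pv; rewrite -subr_eq0 /z0; apply: contraNN => /eqP h; apply/eqP.
    by rewrite -h; ring.
  rewrite cabsM cabsV cabs_cE ler_pM2l//.
  rewrite lef_pV2 ?posrE//; last by rewrite cabs_gt0 subr_eq0 neq.
  rewrite (_ : _ - _ = cE v t - cE p 0); last by rewrite /z0; ring.
  by apply: lt_cabs_distD; rewrite cabs_cE ?vE.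
- rewrite mulrA ler_pdivrMr//.
  have : 2 * pi * expR p = e * (2 * pi * expR p / e) by field; rewrite gt_eqF.
  have := mulr_gt0 e0 U0; rewrite /m !mulrDr mulrN; clear; lra.
Qed.

End circle_integrals.

(** * Cauchy's formula on an annulus *)

Section cauchy_annulus.
Context {R : realType}.
Implicit Types (f F : cplx R -> cplx R) (a z w D : cplx R) (u t : R).

(** On [[- pi, pi]] angle 0 is attained only once, unlike angle [pi]; this is why the evaluation
    point is placed on the positive ray from [a]. *)
Lemma cE_eq_base (p u t : R) : - pi <= t <= pi -> cE u t = cE p 0 -> (u, t) = (p, 0).
Proof.
move=> /andP[t1 t2] E; have up : u = p.
  by have /(congr1 (@cabs R)) := E; rewrite !cabs_cE => /expR_inj.
rewrite up in E *; congr (_, _).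
have : complex.Re (cE p t) = complex.Re (cE p 0) by rewrite E.
rewrite /= cos0 => /(mulfI (lt0r_neq0 (expR_gt0 _))) ct.
have [t0|t0] := leP 0 t.
- by apply: (@cos_inj R); rewrite ?in_itv/= ?t0 ?t2 ?lexx ?pi_ge0// cos0.
- apply: oppr_inj; rewrite oppr0; apply: (@cos_inj R); rewrite ?in_itv/= ?lexx ?pi_ge0//.
    by rewrite oppr_ge0 (ltW t0) lerNl.
  by rewrite cosN cos0.
Qed.

Lemma cdiff_quotient_ccont f z0 D : cdiff f z0 D ->
  ccont (fun w => if w == z0 then D else (f w - f z0) / (w - z0)) z0.
Proof.
move=> df e e0; have [d d0 dF] := df e e0; exists d => // w wd.
rewrite eqxx; have [_|wz] := eqVneq w z0; first by rewrite subrr cabs0 ltW.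
have w0 : 0 < cabs (w - z0) by rewrite cabs_gt0 subr_eq0.
rewrite -(ler_pM2r w0) -cabsM mulrBl divfK ?subr_eq0//; exact: dF.
Qed.

Lemma derivable_quotient f z0 D w : w != z0 -> derivable f w 1 ->
  derivable (fun w => if w == z0 then D else (f w - f z0) / (w - z0)) w 1.
Proof.
move=> wz df.
have : derivable (fun x : cplx R => (f x - f z0) * (x - z0)^-1) w 1.
  apply: derivableM; last exact: derivable_inv_sub.
  by apply: (@derivableB _ _ _ f (cst (f z0))); [exact: df|exact: derivable_cst].
apply: near_eq_derivable.
have : \forall x \near w, x != z0.
  apply/nbhs_ballP; exists `|w - z0|; first by rewrite /= normr_gt0 subr_eq0.
  by move=> x; rewrite -ball_normE /ball_/=; apply: contraTneq => ->; rewrite ltxx.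
by apply: filterS => x /negbTE ->.
Qed.

(** The difference quotient of [f] at [z0], completed by the derivative, has equal integrals over
    both circles. Off [z0] it is [f w / (w - z0) - f z0 / (w - z0)], and the second term integrates
    to 0 on the inner circle and to [2 * pi * f z0] on the outer one. *)
Lemma cauchy_annulus f a (u1 p u2 : R) : u1 < p < u2 ->
  (forall u t, u1 <= u <= u2 -> derivable f (a + cE u t) 1) ->
  circ (fun w => f w / (w - (a + cE p 0))) a u2 - circ (fun w => f w / (w - (a + cE p 0))) a u1
  = (2 * pi)%:C%C * f (a + cE p 0).
Proof.
move=> /andP[u1p pu2] df; set z0 := a + cE p 0.
have hp : u1 <= p <= u2 by rewrite !ltW.
have u12 : u1 <= u2 by rewrite ltW// (lt_trans u1p).
have [D dD] := derivable_cdiff (df p 0 hp).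
pose q w := if w == z0 then D else (f w - f z0) / (w - z0).
have neq u t : u != p -> a + cE u t != z0.
  apply: contraNN => /eqP/addrI/(congr1 (@cabs R)); rewrite !cabs_cE => /expR_inj ->.
  by rewrite eqxx.
have Eq : circ q a u1 = circ q a u2.
  apply: (@circ_indep_except _ _ _ _ p); first by rewrite u1p.
    exact: cdiff_quotient_ccont dD.
  move=> u t hu ht ut; apply/derivable_cdiff/derivable_quotient; last exact: df.
  by apply: contra_neq ut => /addrI; exact: cE_eq_base.
have cf u t : u1 <= u <= u2 -> ccont f (a + cE u t).
  by move=> /(df u t)/derivable_cdiff[E /cdiff_ccont].
have split_q u : u1 <= u <= u2 -> u != p ->
    circ q a u = circ (fun w => f w / (w - z0)) a u - f z0 * circ (fun w => (w - z0)^-1) a u.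
  move=> hu up; have ci t : ccont (fun w => (w - z0)^-1) (a + cE u t).
    by have [E /cdiff_ccont] := cdiff_inv_sub (neq u t up).
  have ci' : ccts (- pi) pi (circ_fun (fun w => (w - z0)^-1) a u) by exact: circ_ccts.
  have cfi : ccts (- pi) pi (circ_fun (fun w => f w / (w - z0)) a u).
    apply: circ_ccts => t _.
    have dfi : derivable (fun w : cplx R => f w * (w - z0)^-1) (a + cE u t) 1.
      by apply: derivableM; [exact: df|exact: derivable_inv_sub (neq u t up)].
    by have [E /cdiff_ccont] := derivable_cdiff dfi.
  have cZ : ccts (- pi) pi (fun t => - f z0 * circ_fun (fun w => (w - z0)^-1) a u t).
    exact: (cctsM (ccts_cst _ _ (- f z0)) ci').
  have E := cintD cfi cZ; rewrite (cintZ (- f z0) ci') in E.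
  rewrite -mulNr; apply: etrans E; apply: eq_cint => t _; rewrite /circ_fun /q (negbTE (neq u t up)).
  by rewrite mulrBl; ring.
have q1 := split_q u1 ltac:(by rewrite lexx) (negbT (lt_eqF u1p)).
have q2 := split_q u2 ltac:(by rewrite lexx andbT) (negbT (gt_eqF pu2)).
rewrite q1 q2 (circ_pole_inside a u1p) (circ_pole_outside a pu2) mulr0 subr0 in Eq.
rewrite Eq.
by rewrite opprB addrCA subrr addr0 mulrC.
Qed.

End cauchy_annulus.

(** * Pointwise estimate by circle integrals *)

Section annulus_estimate.
Context {R : realType}.
Implicit Types (f F : cplx R -> cplx R) (a z w D : cplx R) (u t : R).

(** Since [circ_fun] contains the factor [z - a], this is the density of the square norm of [f] with
    respect to [u], the logarithm of the radius. *)
Definition circ_sqnorm f a u : R := rint (- pi) pi (fun t => cabs (circ_fun f a u t) ^+ 2).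

Lemma comp_ccts F a u : (forall t, ccont F (a + cE u t)) ->
  ccts (- pi) pi (fun t => F (a + cE u t)).
Proof.
move=> cF; split => t _.
- exact: (@rcont_cont2 _ (fun x y => complex.Re (F (a + cE x y))))
    (zcont_Re (zcont_comp (cF t) (zdiff_pol a u t))).
- exact: (@rcont_cont2 _ (fun x y => complex.Im (F (a + cE x y))))
    (zcont_Im (zcont_comp (cF t) (zdiff_pol a u t))).
Qed.

Lemma derivable_ccont f z : derivable f z 1 -> ccont f z.
Proof. by move=> /derivable_cdiff[D /cdiff_ccont]. Qed.

Lemma npi_lt_pi : - pi < pi :> R.
Proof. by have := pi_gt0 R; lra. Qed.

Lemma circ_sqr_le f a u : (forall t, derivable f (a + cE u t) 1) ->
  cabs (circ f a u) ^+ 2 <= 2 * pi * circ_sqnorm f a u.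
Proof.
move=> df.
have cg : ccts (- pi) pi (circ_fun f a u).
  by apply: circ_ccts => t _; exact/derivable_ccont/df.
have h := rint_sqr_le npi_lt_pi (cts_cabs cg).
rewrite (_ : 2 * pi = pi - - pi); last by lra.
apply: le_trans h; rewrite ler_pXn2r ?nnegrE//; first exact: (cabs_cint_le cg).
by apply: rint_ge0 => t _; exact: cabs_ge0.
Qed.

(** Cauchy's formula is multiplied by [z0 - a]. On the outer circle the kernel [(z0 - a) / (z - z0)]
    is already small. On the inner one it equals [(z - a) / (z - z0) - 1]: the first part is small
    and the [- 1] splits off the residue term [circ f a u1]. Cauchy-Schwarz bounds the two small
    parts. *)
Lemma annulus_pointwise f a (u1 p u2 : R) : u1 < p -> p < u2 ->
  (forall u t, u1 <= u <= u2 -> derivable f (a + cE u t) 1) ->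
  2 * pi * (expR p * cabs (f (a + cE p 0))) <= cabs (circ f a u1) +
    expR p / (expR u2 - expR p) * Num.sqrt (2 * pi * circ_sqnorm f a u2) +
    expR u1 / (expR p - expR u1) * Num.sqrt (2 * pi * circ_sqnorm f a u1).
Proof.
move=> u1p pu2 df; set z0 := a + cE p 0.
have E1 : expR u1 < expR p by rewrite ltr_expR.
have E2 : expR p < expR u2 by rewrite ltr_expR.
have u12 : u1 <= u2 by rewrite ltW// (lt_trans u1p).
have h1 : u1 <= u1 <= u2 by rewrite lexx.
have h2 : u1 <= u2 <= u2 by rewrite lexx andbT.
have neq u t : u != p -> a + cE u t != z0.
  apply: contraNN => /eqP/addrI/(congr1 (@cabs R)); rewrite !cabs_cE => /expR_inj ->.
  by rewrite eqxx.
have n1 t : a + cE u1 t - z0 != 0 by rewrite subr_eq0 neq// lt_eqF.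
have n2 t : a + cE u2 t - z0 != 0 by rewrite subr_eq0 neq// gt_eqF.
have cg u : u1 <= u <= u2 -> ccts (- pi) pi (circ_fun f a u).
  by move=> hu; apply: circ_ccts => t _; exact/derivable_ccont/df.
have cinv u : u != p -> ccts (- pi) pi (fun t => (a + cE u t - z0)^-1).
  move=> up; apply: (@comp_ccts (fun w => (w - z0)^-1)) => t.
  exact/derivable_ccont/derivable_inv_sub/neq.
have cexp u : ccts (- pi) pi (fun t => cE u t).
  rewrite (_ : (fun t => _) = fun t => (fun w => w) (0 + cE u t)); last first.
    by apply/funext => t; rewrite add0r.
  by apply: (@comp_ccts (fun w => w) 0 u) => t e e0; exists e.
pose k2 t := cE p 0 * (a + cE u2 t - z0)^-1.
pose k1 t := cE u1 t * (a + cE u1 t - z0)^-1.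
have ck2 : ccts (- pi) pi k2.
  exact: (cctsM (ccts_cst _ _ (cE p 0)) (cinv u2 (negbT (gt_eqF pu2)))).
have ck1 : ccts (- pi) pi k1.
  exact: (cctsM (cexp u1) (cinv u1 (negbT (lt_eqF u1p)))).
pose F w := f w / (w - z0).
have cFu u : u1 <= u <= u2 -> u != p -> ccts (- pi) pi (circ_fun F a u).
  move=> hu up; apply: circ_ccts => t _; apply: derivable_ccont.
  by apply: derivableM; [exact: df|exact: derivable_inv_sub (neq u t up)].
have A2 : cE p 0 * circ F a u2 = cint (- pi) pi (fun t => circ_fun f a u2 t * k2 t).
  rewrite -(cintZ (cE p 0) (cFu u2 h2 (negbT (gt_eqF pu2)))).
  by apply: eq_cint => t _; rewrite /k2 /circ_fun /F; ring.
have A1 : cE p 0 * circ F a u1 = cint (- pi) pi (fun t => circ_fun f a u1 t * k1 t) - circ f a u1.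
  rewrite -(cintZ (cE p 0) (cFu u1 h1 (negbT (lt_eqF u1p)))).
  have cgk := cctsM (cg u1 h1) ck1.
  have cN : ccts (- pi) pi (fun t => - 1 * circ_fun f a u1 t).
    exact: (cctsM (ccts_cst _ _ (- 1)) (cg u1 h1)).
  have E := cintD cgk cN; rewrite (cintZ (- 1) (cg u1 h1)) mulN1r in E.
  apply: etrans E; apply: eq_cint => t _; rewrite /k1 /circ_fun /F.
  have := n1 t; rewrite /z0 => n1t; field.
  by move: n1t; apply: contraNN => /eqP h; apply/eqP; rewrite -h; ring.
have C : cE p 0 * ((2 * pi)%:C%C * f z0) = cE p 0 * circ F a u2 - cE p 0 * circ F a u1.
  by rewrite -(cauchy_annulus (p := p) _ df) ?u1p// -/z0 -/F mulrBr.
have -> : 2 * pi * (expR p * cabs (f z0)) = cabs (cE p 0 * ((2 * pi)%:C%C * f z0)).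
  rewrite !cabsM cabs_cE cabs_real ger0_norm; first by ring.
  by rewrite mulr_ge0// pi_ge0.
rewrite {}C A2 A1 opprB addrCA.
apply: le_trans (cabsD _ _) _; rewrite -addrA; apply: lerD => //.
have twopi : pi - - pi = 2 * pi :> R by lra.
apply: le_trans (cabsB _ _) _; apply: lerD; rewrite /circ_sqnorm -twopi.
- apply: cabs_cint_mul_le => //; [exact: npi_lt_pi| |exact: cg|].
    by rewrite divr_ge0 ?expR_ge0// subr_ge0 ltW.
  move=> t _; rewrite /k2 cabsM cabsV cabs_cE; apply: ler_wpM2l; first exact: expR_ge0.
  rewrite lef_pV2 ?posrE ?cabs_gt0 ?subr_gt0//.
  rewrite (_ : _ - _ = cE u2 t - cE p 0); last by rewrite /z0; ring.
  by apply: lt_cabs_distD; rewrite cabs_cE.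
- apply: cabs_cint_mul_le => //; [exact: npi_lt_pi| |exact: cg|].
    by rewrite divr_ge0 ?expR_ge0// subr_ge0 ltW.
  move=> t _; rewrite /k1 cabsM cabsV cabs_cE; apply: ler_wpM2l; first exact: expR_ge0.
  rewrite lef_pV2 ?posrE ?cabs_gt0 ?subr_gt0//.
  rewrite (_ : _ - _ = cE u1 t - cE p 0); last by rewrite /z0; ring.
  by rewrite cabs_dist; apply: lt_cabs_distD; rewrite cabs_cE.
Qed.

End annulus_estimate.

(** * Affine substitutions for Lebesgue measure on the line *)

Section plane_integrals.
Context {R : realType}.
Notation mu := (@lebesgue_measure R).
Local Open Scope ereal_scope.

Lemma measurable_affine (k b : R) : measurable_fun [set: measurableTypeR R] (fun x : R => k * x + b)%R.
Proof. by apply: measurable_funD => //; exact: measurable_funM. Qed.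

(** By uniqueness of Lebesgue measure it suffices to compare the two measures on half-open
    intervals. *)
Lemma lebesgue_measure_affine (k b : R) (k0 : (0 < k)%R) (A : set R) : measurable A ->
  mu A = k%:E * pushforward mu (fun x : measurableTypeR R => k * x + b : measurableTypeR R)%R A.
Proof.
move=> mA.
pose phi := (fun x : measurableTypeR R => k * x + b : measurableTypeR R)%R.
have mphi : measurable_fun setT phi by exact: measurable_affine.
pose nu : {measure set (measurableTypeR R) -> \bar R} :=
  mscale (NngNum (ltW k0)) (pushforward mu phi).
rewrite -[RHS]/(nu mphi A); apply: lebesgue_measure_unique => // _ [[x y]] _ <-.
have E : phi @^-1` [set` `]x, y]%R] = [set` `](x - b) / k, (y - b) / k]%R].
  apply/seteqP; split => z /=; rewrite !in_itv/= /phi ltr_pdivrMr// ler_pdivlMr//;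
    by rewrite ltrBlDr lerBrDr [(z * k)%R]mulrC.
rewrite -[RHS]/(k%:E * mu (phi @^-1` [set` `]x, y]%R])) E.
rewrite !lebesgue_measure_itv/= !lte_fin ltr_pM2r ?invr_gt0// ltrD2r.
case: ifPn => _; last by rewrite mule0.
rewrite -!EFinB -EFinM; congr (_%:E).
by field; rewrite gt_eqF.
Qed.

Lemma ge0_integral_affine (k b : R) (f : R -> \bar R) : (0 < k)%R ->
  measurable_fun setT f -> (forall x, 0 <= f x) ->
  \int[mu]_x f x = k%:E * \int[mu]_x f (k * x + b)%R.
Proof.
move=> k0 mf f0.
pose phi := (fun x : measurableTypeR R => k * x + b : measurableTypeR R)%R.
have mphi : measurable_fun setT phi by exact: measurable_affine.
pose pm : {measure set (measurableTypeR R) -> \bar R} := pushforward mu phi.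
have -> : \int[mu]_x f (k * x + b)%R = \int[mu]_(x in phi @^-1` setT) (f \o phi) x.
  by rewrite preimage_setT.
rewrite -ge0_integral_pushforward//.
rewrite -(@ge0_integral_mscale _ _ _ (pm mphi) setT measurableT (NngNum (ltW k0)) f)//.
by apply: eq_measure_integral => A mA _; exact: lebesgue_measure_affine.
Qed.

Lemma ge0_integral_opp (f : R -> \bar R) : measurable_fun setT f -> (forall x, 0 <= f x) ->
  \int[mu]_x f x = \int[mu]_x f (- x)%R.
Proof.
move=> mf f0; rewrite -{2}(preimage_setT (-%R : _ -> measurableTypeR R)).
rewrite -(ge0_integral_pushforward (phi := (-%R : measurableTypeR R -> measurableTypeR R)))//.
by apply: eq_measure_integral => A mA _; exact/esym/lebesgue_measureN.
Qed.

End plane_integrals.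

(** * Invariance of area and decomposition into four sectors *)

Section polar_coordinates.
Context {R : realType}.
Notation mu := (@lebesgue_measure R).
Notation RR := (measurableTypeR R * measurableTypeR R)%type.
Local Open Scope ereal_scope.
Implicit Type Psi : RR -> \bar R.

Lemma measurable_pmap Psi (f g : RR -> R) : measurable_fun setT Psi ->
  measurable_fun setT f -> measurable_fun setT g ->
  measurable_fun setT (fun p => Psi (f p, g p)).
Proof.
move=> mPsi mf mg.
by apply: (measurableT_comp mPsi); exact: measurable_fun_pair.
Qed.

Lemma area_translate Psi (b1 b2 : R) : measurable_fun setT Psi -> (forall p, 0 <= Psi p) ->
  \int[area R]_p Psi p = \int[area R]_p Psi (b1 + p.1, b2 + p.2)%R.
Proof.
move=> mPsi Psi0.
rewrite fubini_tonelli1// [in RHS]fubini_tonelli1//; last first.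
  by apply: measurable_pmap => //; apply: measurable_funD => //.
rewrite /fubini_F (@ge0_integral_affine _ 1 b1 _ ltr01)//; last 2 first.
- exact: (measurable_fun_fubini_tonelli_F Psi).
- by move=> x; exact: integral_ge0.
rewrite mul1e; apply: eq_integral => x _ /=.
rewrite (@ge0_integral_affine _ 1 b2 _ ltr01)//; last exact: measurable_fun_pair2.
by rewrite mul1e; apply: eq_integral => y _; rewrite !mul1r ![(_ + b1)%R]addrC ![(_ + b2)%R]addrC.
Qed.

Definition rot (p : RR) : RR := (- p.2, p.1)%R.

Lemma measurable_rot Psi : measurable_fun setT Psi -> measurable_fun setT (Psi \o rot).
Proof. by move=> mPsi; apply: measurable_pmap => //; exact: measurable_funN. Qed.

(** A quarter turn exchanges the coordinates up to one reflection: Tonelli handles the exchange,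
    [ge0_integral_opp] the reflection. *)
Lemma area_rot Psi : measurable_fun setT Psi -> (forall p, 0 <= Psi p) ->
  \int[area R]_p Psi p = \int[area R]_p Psi (rot p).
Proof.
move=> mPsi Psi0.
have mr : measurable_fun setT (Psi \o rot) by exact: measurable_rot.
rewrite fubini_tonelli1// (fubini_tonelli2 (Psi \o rot))//.
rewrite /fubini_F /fubini_G (@ge0_integral_opp _ (fun x => \int[mu]_y Psi (x, y)))//; last 2 first.
- exact: (measurable_fun_fubini_tonelli_F Psi).
- by move=> x; exact: integral_ge0.
by move=> p; exact: Psi0.
Qed.

Definition sector (Psi : RR -> \bar R) (p : RR) : \bar R :=
  if (`|p.2| < p.1)%R then Psi p else 0.

Lemma measurable_if_lt Psi (f g : RR -> R) : measurable_fun setT Psi ->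
  measurable_fun setT f -> measurable_fun setT g ->
  measurable_fun setT (fun p => if (f p < g p)%R then Psi p else 0).
Proof.
move=> mPsi mf mg.
by apply: measurable_fun_ifT => //; exact: measurable_fun_ltr.
Qed.

Lemma measurable_norm_fst : measurable_fun setT (fun p : RR => `|p.1|%R).
Proof. by apply: measurableT_comp => //; exact: measurable_fst. Qed.

Lemma measurable_norm_snd : measurable_fun setT (fun p : RR => `|p.2|%R).
Proof. by apply: measurableT_comp => //; exact: measurable_snd. Qed.

(** The quarter turns of the cone [|y| < x] are pairwise disjoint and miss only the two diagonals.
    An inequality is enough for the lower bounds to come, so the diagonals need not be shown
    negligible. *)
Lemma four_sectors Psi : measurable_fun setT Psi -> (forall p, 0 <= Psi p) ->
  \int[area R]_p sector Psi p + \int[area R]_p sector (Psi \o rot) p +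
  (\int[area R]_p sector (Psi \o rot \o rot) p +
   \int[area R]_p sector (Psi \o rot \o rot \o rot) p) <= \int[area R]_p Psi p.
Proof.
move=> mPsi Psi0.
have mf := @measurable_fst _ _ (measurableTypeR R) (measurableTypeR R).
have ms := @measurable_snd _ _ (measurableTypeR R) (measurableTypeR R).
(* [S1], [S2], [S3] restrict [Psi] to the cones around the other half-axes; rotations bring each
   back to the first cone. *)
pose S1 (p : RR) := if (`|p.1| < p.2)%R then Psi p else 0.
pose S2 (p : RR) := if (`|p.2| < - p.1)%R then Psi p else 0.
pose S3 (p : RR) := if (`|p.1| < - p.2)%R then Psi p else 0.
have m0 : measurable_fun setT (sector Psi).
  by apply: measurable_if_lt => //; exact: measurable_norm_snd.
have m1 : measurable_fun setT S1.
  by apply: measurable_if_lt => //; exact: measurable_norm_fst.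
have m2 : measurable_fun setT S2.
  by apply: measurable_if_lt => //; [exact: measurable_norm_snd|exact: measurable_funN].
have m3 : measurable_fun setT S3.
  by apply: measurable_if_lt => //; [exact: measurable_norm_fst|exact: measurable_funN].
have p0 p : 0 <= sector Psi p by rewrite /sector; case: ifP.
have p1 p : 0 <= S1 p by rewrite /S1; case: ifP.
have p2 p : 0 <= S2 p by rewrite /S2; case: ifP.
have p3 p : 0 <= S3 p by rewrite /S3; case: ifP.
have -> : \int[area R]_p sector (Psi \o rot) p = \int[area R]_p S1 p.
  rewrite (area_rot m1 p1); apply: eq_integral => -[x y] _.
  by rewrite /sector /S1 /rot/= normrN.
have -> : \int[area R]_p sector (Psi \o rot \o rot) p = \int[area R]_p S2 p.
  rewrite (area_rot m2 p2) (area_rot (measurable_rot m2) (fun p => p2 _)).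
  apply: eq_integral => -[x y] _.
  by rewrite /sector /S2 /rot/= opprK normrN.
have -> : \int[area R]_p sector (Psi \o rot \o rot \o rot) p = \int[area R]_p S3 p.
  rewrite (area_rot m3 p3) (area_rot (measurable_rot m3) (fun p => p3 _)).
  rewrite (area_rot (measurable_rot (measurable_rot m3)) (fun p => p3 _)).
  apply: eq_integral => -[x y] _.
  by rewrite /sector /S3 /rot/= !opprK.
rewrite -ge0_integralD// -ge0_integralD// -ge0_integralD//; last 4 first.
- by move=> p _; exact: adde_ge0.
- exact: emeasurable_funD.
- by move=> p _; exact: adde_ge0.
- exact: emeasurable_funD.
apply: ge0_le_integral => //.
- by move=> p _; apply: adde_ge0; exact: adde_ge0.
- by apply: emeasurable_funD; exact: emeasurable_funD.
- move=> [x y] _; rewrite /sector /S1 /S2 /S3/=.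
  do 4 case: ifPn => ?; rewrite ?adde0 ?add0e//; exfalso.
  all: repeat match goal with H : is_true (_ < _)%R |- _ => move: H end.
  all: rewrite !ltr_norml => *; repeat match goal with H : is_true (_ && _) |- _ => move/andP: H => [? ?] end; lra.
Qed.

End polar_coordinates.

(** * Polar coordinates in one sector, with the slope as angular variable *)

Section sector_integral.
Context {R : realType}.
Notation mu := (@lebesgue_measure R).
Notation RR := (measurableTypeR R * measurableTypeR R)%type.
Local Open Scope ereal_scope.
Implicit Type Psi : RR -> \bar R.

(** The cosine of [atan v], for [v] the slope of a ray. *)
Definition slope_cos (v : R) : R := (Num.sqrt (1 + v ^+ 2))^-1%R.

Lemma slope_cos_gt0 v : (0 < slope_cos v)%R.
Proof. by rewrite invr_gt0 sqrtr_gt0 ltr_pwDl// sqr_ge0. Qed.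

Lemma measurable_slope_cos : measurable_fun setT slope_cos.
Proof.
apply: continuous_measurable_fun => v; apply: cvgV.
  by rewrite gt_eqF// sqrtr_gt0 ltr_pwDl// sqr_ge0.
apply: continuous_comp; last exact: sqrt_continuous.
by apply: cvgD; [exact: cvg_cst|exact: exprn_continuous].
Qed.

(** The sector integrand after [y = x v]; the leading factor [x] is the Jacobian. *)
Definition slope_fun Psi (p : RR) : \bar R :=
  if (`|p.2| < 1)%R then if (0 < p.1)%R then
    p.1%:E * Psi (p.1, p.1 * p.2)%R else 0 else 0.

(** The same after [x = t * slope_cos v], which makes [t] the radius: the Jacobian [x] becomes
    [t * slope_cos v] and [dx] brings one more [slope_cos v]. *)
Definition polar_slope_fun Psi (p : RR) : \bar R :=
  if (`|p.2| < 1)%R then if (0 < p.1)%R then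
    (p.1 * slope_cos p.2 ^+ 2)%:E *
      Psi (p.1 * slope_cos p.2, p.1 * slope_cos p.2 * p.2)%R else 0 else 0.

Lemma slope_fun_ge0 Psi p : (forall p, 0 <= Psi p) -> 0 <= slope_fun Psi p.
Proof.
move=> Psi0; rewrite /slope_fun; case: ifP => // _; case: ifPn => // x0.
by rewrite mule_ge0// lee_fin ltW.
Qed.

Lemma polar_slope_fun_ge0 Psi p : (forall p, 0 <= Psi p) -> 0 <= polar_slope_fun Psi p.
Proof.
move=> Psi0; rewrite /polar_slope_fun; case: ifP => // _; case: ifPn => // x0.
by rewrite mule_ge0// lee_fin mulr_ge0 ?sqr_ge0// ltW.
Qed.

Lemma measurable_slope_fun Psi : measurable_fun setT Psi -> measurable_fun setT (slope_fun Psi).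
Proof.
move=> mPsi.
have mf := @measurable_fst _ _ (measurableTypeR R) (measurableTypeR R).
have ms := @measurable_snd _ _ (measurableTypeR R) (measurableTypeR R).
apply: measurable_if_lt => //; last exact: measurable_norm_snd.
apply: measurable_if_lt => //.
apply: emeasurable_funM; first exact/measurable_EFinP.
by apply: measurable_pmap => //; exact: measurable_funM.
Qed.

Lemma measurable_polar_slope_fun Psi : measurable_fun setT Psi ->
  measurable_fun setT (polar_slope_fun Psi).
Proof.
move=> mPsi.
have mf := @measurable_fst _ _ (measurableTypeR R) (measurableTypeR R).
have ms := @measurable_snd _ _ (measurableTypeR R) (measurableTypeR R).
have mc : measurable_fun setT (fun p : RR => slope_cos p.2).
  by apply: (measurableT_comp measurable_slope_cos).
have mfc : measurable_fun setT (fun p : RR => p.1 * slope_cos p.2)%R.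
  exact: measurable_funM.
apply: measurable_if_lt => //; last exact: measurable_norm_snd.
apply: measurable_if_lt => //.
apply: emeasurable_funM.
  by apply/measurable_EFinP; apply: measurable_funM => //; exact: measurable_funX.
by apply: measurable_pmap => //; exact: measurable_funM.
Qed.

Lemma integral_sector_slope Psi : measurable_fun setT Psi -> (forall p, 0 <= Psi p) ->
  \int[area R]_p sector Psi p = \int[area R]_p slope_fun Psi p.
Proof.
move=> mPsi Psi0.
have mS : measurable_fun setT (sector Psi).
  by apply: measurable_if_lt => //; exact: measurable_norm_snd.
have S0 p : 0 <= sector Psi p by rewrite /sector; case: ifP.
have T0 p : 0 <= slope_fun Psi p by exact: slope_fun_ge0.
rewrite (fubini_tonelli1 (sector Psi) mS S0).
rewrite (fubini_tonelli1 (slope_fun Psi) (measurable_slope_fun mPsi) T0).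
apply: eq_integral => x _; rewrite /fubini_F.
have [x0|x0] := ltP 0%R x; last first.
  rewrite !integral0_eq// => y _; rewrite /slope_fun /sector/=.
    by rewrite (ltNge 0%R x) x0/=; case: ifP.
  by rewrite ltNge (le_trans x0).
rewrite (@ge0_integral_affine _ x 0 (fun y => sector Psi (x, y)) x0)//; last first.
  exact: measurable_fun_pair2.
rewrite -ge0_integralZl//; first last.
- by rewrite lee_fin ltW.
- apply: (measurableT_comp (measurable_fun_pair2 x mS)).
  by apply: measurable_funD => //; exact: measurable_funM.
apply: eq_integral => v _; rewrite /slope_fun /sector/= x0 addr0.
rewrite normrM (gtr0_norm x0) gtr_pMr//.
by case: ifP => // _; rewrite mule0.
Qed.

(** With the slope fixed, passing from the abscissa to the radius is linear, so the affine rule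
    suffices here as it does for [y = x v]. *)
Lemma integral_slope_polar Psi : measurable_fun setT Psi -> (forall p, 0 <= Psi p) ->
  \int[area R]_p slope_fun Psi p = \int[area R]_p polar_slope_fun Psi p.
Proof.
move=> mPsi Psi0.
have mS := measurable_slope_fun mPsi.
have S0 p : 0 <= slope_fun Psi p by exact: slope_fun_ge0.
have T0 p : 0 <= polar_slope_fun Psi p by exact: polar_slope_fun_ge0.
rewrite (fubini_tonelli2 (slope_fun Psi) mS S0).
rewrite (fubini_tonelli2 (polar_slope_fun Psi) (measurable_polar_slope_fun mPsi) T0).
apply: eq_integral => v _; rewrite /fubini_G.
have c0 := slope_cos_gt0 v.
rewrite (@ge0_integral_affine _ (slope_cos v) 0 (fun x => slope_fun Psi (x, v)) c0)//; last exact: measurable_fun_pair1.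
rewrite -ge0_integralZl//; first last.
- by rewrite lee_fin ltW.
- apply: (measurableT_comp (measurable_fun_pair1 v mS)).
  by apply: measurable_funD => //; exact: measurable_funM.
apply: eq_integral => t _; rewrite /slope_fun /polar_slope_fun/= addr0.
rewrite pmulr_rgt0//; case: ifP => [_|]; last by rewrite mule0.
case: ifP => [_|]; last by rewrite mule0.
rewrite muleA -EFinM; congr (_%:E * _); first by ring.
by rewrite [(slope_cos v * t)%R]mulrC.
Qed.

Lemma integral_sector_polar Psi : measurable_fun setT Psi -> (forall p, 0 <= Psi p) ->
  \int[area R]_p sector Psi p = \int[mu]_t \int[mu]_v polar_slope_fun Psi (t, v).
Proof.
move=> mPsi Psi0; rewrite integral_sector_slope// integral_slope_polar//.
apply: (fubini_tonelli1 (polar_slope_fun Psi) (measurable_polar_slope_fun mPsi)) => p.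
exact: polar_slope_fun_ge0.
Qed.

End sector_integral.

(** * From slopes to angles, and four arcs to a full circle *)

Section arcs.
Context {R : realType}.
Notation mu := (@lebesgue_measure R).
Notation RR := (measurableTypeR R * measurableTypeR R)%type.
Implicit Types (F dF H : R -> R) (a b c x t : R).

Lemma EFin_rint a b H : cts a b H -> (\int[mu]_(x in `[a, b]) (H x)%:E = (rint a b H)%:E)%E.
Proof.
move=> cH; rewrite /rint /Rintegral fineK//.
by have := integrable_fin_num _ (cts_integrable cH); apply.
Qed.

Lemma rint_subst F dF H a b : a <= b -> {homo F : x y / x < y} ->
  (forall x : R, is_derive x (1 : R) F (dF x)) -> continuous dF -> continuous H ->
  rint (F a) (F b) H = rint a b (fun x => H (F x) * dF x).
Proof.
move=> ab Fm FdF cdF cH.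
have cF : continuous F.
  by move=> x; apply: differentiable_continuous; apply/derivable1_diffP; case: (FdF x).
have dE : derive1 F = dF by apply/funext => x; rewrite derive1E; case: (FdF x).
apply: EFin_inj; rewrite -EFin_rint; last by move=> x _; exact: cH.
rewrite integration_by_substitution_increasing ?dE//.
- rewrite -EFin_rint//; apply: ctsM => x _; last exact: cdF.
  by apply: continuous_comp; [exact: cF|exact: cH].
- by move=> x y _ _; exact: Fm.
- by apply: (cvgP (dF a)); exact: cvg_at_right_filter (cdF a).
- by apply: (cvgP (dF b)); exact: cvg_at_left_filter (cdF b).
- split; first by move=> x _; case: (FdF x).
  + exact: cvg_at_right_filter (cF a).
  + exact: cvg_at_left_filter (cF b).
- exact: continuous_subspaceT.
Qed.

Lemma rint_shift H a b c a' b' : a <= b -> continuous H -> a + c = a' -> b + c = b' ->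
  rint a b (fun x => H (x + c)) = rint a' b' H.
Proof.
move=> ab cH <- <-.
have dF x : is_derive x (1 : R) (fun x => x + c) (cst (1 : R) x).
  by apply: is_derive_eq; rewrite addr0.
rewrite (rint_subst ab _ dF _ cH).
- by apply: eq_rint => x _; rewrite mulr1.
- by move=> x y xy; rewrite ltrD2r.
- by move=> x; exact: cvg_cst.
Qed.

Lemma rint_four_arcs H : continuous H -> (forall t, H (t + 2 * pi) = H t) ->
  rint (- (pi / 4)) (pi / 4) H + rint (- (pi / 4)) (pi / 4) (fun t => H (t + pi / 2)) +
  (rint (- (pi / 4)) (pi / 4) (fun t => H (t + pi)) +
   rint (- (pi / 4)) (pi / 4) (fun t => H (t + 3 * pi / 2))) = rint (- pi) pi H.
Proof.
move=> cH perH; have pi0 := pi_gt0 R.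
have cs a b : cts a b H by move=> x _; exact: cH.
have csh a b c : cts a b (fun t => H (t + c)).
  move=> x _; apply: continuous_comp; last exact: cH.
  by apply: cvgD; [exact: cvg_id|exact: cvg_cst].
have E3 : rint (- (pi / 4)) (pi / 4) (fun t => H (t + 3 * pi / 2)) =
    rint (- (3 * pi / 4)) (- (pi / 4)) H.
  rewrite (_ : (fun t => _) = (fun t => H (t + - (pi / 2)))); last first.
    by apply/funext => t; rewrite -[in RHS]perH; congr H; lra.
  by apply: rint_shift => //; lra.
(* The arc around angle [pi] leaves [[- pi, pi]]; it is cut at its midpoint and its second half
   moved back by one period. *)
have E2 : rint (- (pi / 4)) (pi / 4) (fun t => H (t + pi)) =
    rint (3 * pi / 4) pi H + rint (- pi) (- (3 * pi / 4)) H.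
  rewrite (@rint_split _ _ _ 0)//; last by lra.
  congr (_ + _); first by apply: rint_shift => //; lra.
  rewrite (_ : (fun t => _) = (fun t => H (t + - pi))); last first.
    by apply/funext => t; rewrite -[in RHS]perH; congr H; lra.
  by apply: rint_shift => //; lra.
have E1 : rint (- (pi / 4)) (pi / 4) (fun t => H (t + pi / 2)) =
    rint (pi / 4) (3 * pi / 4) H.
  by apply: rint_shift => //; lra.
rewrite E1 E2 E3 (@rint_split _ (- pi) pi (- (3 * pi / 4)))//; last by lra.
rewrite (@rint_split _ (- (3 * pi / 4)) pi (- (pi / 4)))//; last by lra.
rewrite (@rint_split _ (- (pi / 4)) pi (pi / 4))//; last by lra.
rewrite (@rint_split _ (pi / 4) pi (3 * pi / 4))//; last by lra.
by ring.
Qed.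

Lemma sin_atan_slope (v : R) : sin (atan v) = slope_cos v * v.
Proof.
have c0 : cos (atan v) != 0 by rewrite cos_atan gt_eqF// slope_cos_gt0.
have := atanK v; rewrite /tan => /(congr1 (fun x => cos (atan v) * x)).
by rewrite mulrC divfK// => ->; rewrite cos_atan.
Qed.

(** The substitution is [th = atan v]: the factor [slope_cos v ^+ 2] equals [1 / (1 + v^2)], the
    derivative of [atan], and slopes in []-1, 1[] become angles up to [pi / 4]. *)
Lemma integral_polar_slope (Psi : RR -> \bar R) H t : 0 < t -> continuous H ->
  (forall th, Psi (t * cos th, t * sin th) = (H th)%:E) ->
  (\int[mu]_v polar_slope_fun Psi (t, v) = (t * rint (- (pi / 4)) (pi / 4) H)%:E)%E.
Proof.
move=> t0 cH PH.
have slope2 v : slope_cos v ^+ 2 = (1 + v ^+ 2)^-1.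
  by rewrite /slope_cos exprVn sqr_sqrtr// addr_ge0// sqr_ge0.
have cd : continuous (fun v : R => (1 + v ^+ 2)^-1).
  move=> v; apply: cvgV; first by rewrite gt_eqF// ltr_pwDl// sqr_ge0.
  by apply: cvgD; [exact: cvg_cst|exact: exprn_continuous].
pose G v := t * (H (atan v) * (1 + v ^+ 2)^-1).
have cG : continuous G.
  move=> v; apply: cvgM; first exact: cvg_cst.
  apply: cvgM; last exact: cd.
  by apply: continuous_comp; [exact: continuous_atan|exact: cH].
have GE v : polar_slope_fun Psi (t, v) = ((fun v => (G v)%:E) \_ `](-1)%R, 1%R[) v.
  rewrite /polar_slope_fun/= t0 patchE mem_setE.
  rewrite in_itv/= -ltr_norml; case: ifP => // _.
  rewrite -mulrA -sin_atan_slope [slope_cos v in X in Psi X](_ : _ = cos (atan v)); last first.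
    by rewrite cos_atan.
  by rewrite PH slope2 -EFinM /G; congr (_%:E); ring.
have mG : measurable_fun setT (fun v => (G v)%:E).
  by apply/measurable_EFinP; apply: continuous_measurable_fun; exact: cG.
under eq_integral do rewrite GE.
rewrite -integral_mkcond integral_itv_obnd_cbnd; last first.
  exact: measurable_funTS mG.
rewrite integral_itv_bndo_bndc; last first.
  exact: measurable_funTS mG.
rewrite EFin_rint; last by move=> x _; exact: cG.
congr (_%:E); rewrite rintZ.
  have N11 : -1 <= 1 :> R by lra.
  have dA v : is_derive v (1 : R) (@atan R) ((fun v => (1 + v ^+ 2)^-1) v) by apply: is_derive_eq.
  by congr (_ * _); rewrite -atan1 -atanN (rint_subst N11 (@lt_atan R) dA cd cH).
move=> v _; apply: cvgM; last exact: cd.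
by apply: continuous_comp; [exact: continuous_atan|exact: cH].
Qed.

End arcs.

(** * Lower bound for an area integral over an annulus *)

Section polar_lower_bound.
Context {R : realType}.
Notation mu := (@lebesgue_measure R).
Notation RR := (measurableTypeR R * measurableTypeR R)%type.

Lemma integral_inv (c v1 v2 : R) : v1 <= v2 ->
  (\int[mu]_(x in `[expR v1, expR v2]) (c / x)%:E = (c * (v2 - v1))%:E)%E.
Proof.
rewrite le_eqVlt => /predU1P[<-|v12].
  by rewrite set_itv1 integral_set1 subrr mulr0.
have x0 (x : R) : expR v1 <= x -> 0 < x by apply: lt_le_trans; exact: expR_gt0.
have dF (x : R) : 0 < x -> is_derive x 1 (fun x => c * ln x) (c / x).
  by move=> xp; exact: (@is_deriveZ _ _ _ (@ln R) c x 1 _ (is_derive1_ln xp)).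
have cF (x : R) : 0 < x -> {for x, continuous (fun x => c * ln x)}.
  by move=> /dF d; apply: differentiable_continuous; apply/derivable1_diffP; case: d.
rewrite (@continuous_FTC2 _ _ (fun x => c * ln x))//=.
- by rewrite !expRK -EFinB -mulrBr.
- by rewrite ltr_expR.
- apply: cts_within => x /andP[/x0 xp _]; apply: cvgM; first exact: cvg_cst.
  by apply: cvgV; [rewrite gt_eqF|exact: cvg_id].
- split.
  + by move=> x /=; rewrite in_itv/= => /andP[/ltW/x0/dF d _]; case: d.
  + exact: cvg_at_right_filter (cF _ (expR_gt0 _)).
  + exact: cvg_at_left_filter (cF _ (expR_gt0 _)).
- by move=> x; rewrite in_itv/= => /andP[/ltW/x0/dF d _]; rewrite derive1E; case: d.
Qed.

Lemma integral_le_four (g0 g1 g2 g3 : R -> \bar R) (h : R -> R) (a b : R) :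
  measurable_fun setT g0 -> measurable_fun setT g1 ->
  measurable_fun setT g2 -> measurable_fun setT g3 ->
  (forall x, 0 <= g0 x)%E -> (forall x, 0 <= g1 x)%E ->
  (forall x, 0 <= g2 x)%E -> (forall x, 0 <= g3 x)%E ->
  cts a b h -> (forall x, a <= x <= b -> 0 <= h x) ->
  (forall x, a <= x <= b -> ((h x)%:E <= g0 x + g1 x + (g2 x + g3 x))%E) ->
  (\int[mu]_(x in `[a, b]) (h x)%:E <=
   \int[mu]_x g0 x + \int[mu]_x g1 x + (\int[mu]_x g2 x + \int[mu]_x g3 x))%E.
Proof.
move=> m0 m1 m2 m3 p0 p1 p2 p3 ch h0 hg.
have m01 := emeasurable_funD m0 m1; have m23 := emeasurable_funD m2 m3.
rewrite -ge0_integralD// -ge0_integralD// -ge0_integralD//; first last.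
- by move=> t _; exact: adde_ge0.
- by move=> t _; exact: adde_ge0.
rewrite [leLHS]integral_mkcond; apply: ge0_le_integral => //.
- by move=> x _; rewrite patchE; case: ifPn => // /set_mem/=; rewrite in_itv/= lee_fin => /h0.
- apply/(measurable_restrictT _ _).1 => //; apply/measurable_EFinP.
  by apply: subspace_continuous_measurable_fun => //; exact: cts_within.
- exact: emeasurable_funD.
move=> x _; rewrite patchE; case: ifPn => [/set_mem/=|_]; first by rewrite in_itv/=; exact: hg.
by apply: adde_ge0; exact: adde_ge0.
Qed.

(** At radius [x] the four arcs add up to [x] times the integral of [H] over the circle, which is at
    least [c / x] by hypothesis; integrating over the radii gives [c] times the logarithmic
    width. *)
Lemma polar_area_ge (Psi : RR -> \bar R) (H : R -> R -> R) (c v1 v2 : R) :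
  measurable_fun setT Psi -> (forall p, 0 <= Psi p)%E -> 0 <= c -> v1 <= v2 ->
  (forall u, v1 <= u <= v2 -> continuous (H u)) ->
  (forall u th, v1 <= u <= v2 -> Psi (expR u * cos th, expR u * sin th) = (H u th)%:E) ->
  (forall u, v1 <= u <= v2 -> c <= expR u ^+ 2 * rint (- pi) pi (H u)) ->
  ((c * (v2 - v1))%:E <= \int[area R]_p Psi p)%E.
Proof.
move=> mPsi Psi0 c0 v12 cH PH Hc.
apply: le_trans (four_sectors mPsi Psi0).
have m1 := measurable_rot mPsi; have m2 := measurable_rot m1; have m3 := measurable_rot m2.
have F0 (Phi : RR -> \bar R) : (forall p, 0 <= Phi p)%E ->
    forall t : R, (0 <= \int[mu]_v polar_slope_fun Phi (t, v))%E.
  by move=> P0 t; apply: integral_ge0 => v _; exact: polar_slope_fun_ge0.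
have mF (Phi : RR -> \bar R) : (forall p, 0 <= Phi p)%E -> measurable_fun setT Phi ->
    measurable_fun setT (fun t : R => \int[mu]_v polar_slope_fun Phi (t, v))%E.
  move=> P0 mPhi; apply: (measurable_fun_fubini_tonelli_F (polar_slope_fun Phi)).
    exact: measurable_polar_slope_fun.
  by move=> p; exact: polar_slope_fun_ge0.
have q1 p : (0 <= (Psi \o rot) p)%E by exact: Psi0.
have q2 p : (0 <= (Psi \o rot \o rot) p)%E by exact: Psi0.
have q3 p : (0 <= (Psi \o rot \o rot \o rot) p)%E by exact: Psi0.
rewrite (integral_sector_polar mPsi Psi0) (integral_sector_polar m1 q1).
rewrite (integral_sector_polar m2 q2) (integral_sector_polar m3 q3).
have M0 := mF _ Psi0 mPsi; have M1 := mF _ q1 m1; have M2 := mF _ q2 m2; have M3 := mF _ q3 m3.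
have f0 := F0 _ Psi0; have f1 := F0 _ q1; have f2 := F0 _ q2; have f3 := F0 _ q3.
rewrite -integral_inv//.
apply: integral_le_four => //.
- move=> x /andP[x1 _]; apply: cvgM; first exact: cvg_cst.
  by apply: cvgV; [rewrite gt_eqF// (lt_le_trans _ x1)// expR_gt0|exact: cvg_id].
- by move=> x /andP[x1 _]; rewrite divr_ge0// (le_trans _ x1)// expR_ge0.
move=> x /andP[x1 x2].
have x0 : 0 < x by rewrite (lt_le_trans _ x1)// expR_gt0.
have [u ux] : exists u, x = expR u by exists (ln x); rewrite lnK.
have uv : v1 <= u <= v2 by rewrite -(ler_expR v1) -(ler_expR u) -ux x1.
have cHu := cH u uv.
have csh d : continuous (fun t => H u (t + d)).
  move=> t; apply: continuous_comp; last exact: cHu.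
  by apply: cvgD; [exact: cvg_id|exact: cvg_cst].
have Pu th : Psi (x * cos th, x * sin th) = (H u th)%:E by rewrite ux PH.
have per th : H u (th + 2 * pi) = H u th.
  apply: EFin_inj; rewrite -!Pu (_ : 2 * pi = pi *+ 2); last by rewrite mulr_natl.
  by rewrite cosD2pi sinD2pi.
rewrite (integral_polar_slope x0 cHu Pu).
rewrite (@integral_polar_slope _ _ (fun t => H u (t + pi / 2)) _ x0 (csh _)); last first.
  by move=> th; rewrite -Pu /rot/= cosDpihalf sinDpihalf mulrN.
rewrite (@integral_polar_slope _ _ (fun t => H u (t + pi)) _ x0 (csh _)); last first.
  by move=> th; rewrite -Pu /rot/= cosDpi sinDpi !mulrN.
rewrite (@integral_polar_slope _ _ (fun t => H u (t + 3 * pi / 2)) _ x0 (csh _)); last first.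
  move=> th; rewrite -Pu /rot/= (_ : th + 3 * pi / 2 = th + pi / 2 + pi); last by lra.
  by rewrite cosDpi sinDpi cosDpihalf sinDpihalf !mulrN !opprK.
rewrite -!EFinD lee_fin -!mulrDr (rint_four_arcs cHu per).
rewrite ler_pdivrMr// mulrC mulrA -expr2 ux; exact: Hc.
Qed.

End polar_lower_bound.

(** * Neighbourhoods in the plane and measurability of open sets *)

Section plane_topology.
Context {R : realType}.
Implicit Types (z w : cplx R) (A Om : set (cplx R)).

Lemma nbhs_cabs z A :
  nbhs z A <-> exists2 e : R, 0 < e & forall w, cabs (w - z) < e -> A w.
Proof.
split => [/nbhs_ballP[d /= d0 dA]|[e e0 eA]].
- have [d1 d1E] : exists d1 : R, d = d1%:C%C.
    move: d0; rewrite ltcE /= => /andP[/eqP d00 _]; exists (complex.Re d).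
    by apply/eqP; rewrite eq_complex/= d00 !eqxx.
  have d10 : 0 < d1 by rewrite d1E ltcR in d0.
  exists d1 => // w wz; apply: dA.
  by rewrite -ball_normE /ball_/= normE d1E ltcR cabs_dist.
- apply/nbhs_ballP; exists (e%:C%C) => /=; first by rewrite ltcR.
  by move=> w; rewrite -ball_normE /ball_/= normE ltcR cabs_dist => /eA.
Qed.

Lemma open_cabs Om : open Om -> forall z, Om z ->
  exists2 e : R, 0 < e & forall w, cabs (w - z) < e -> Om w.
Proof. by move=> oOm z Oz; apply/nbhs_cabs; exact: open_nbhs_nbhs. Qed.

Lemma exists_rat_near (x e : R) : 0 < e -> exists q : rat, `|x - ratr q| < e.
Proof.
move=> e0.
have [||r [rB [q _ qr]]] := @dense_rat R (ball x e).
- by exists x; exact: ballxx.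
- exact: ball_open.
exists q; rewrite qr.
by move: rB; rewrite -ball_normE /ball_/=.
Qed.

(* An open set is a union of squares with rational centres and radii 1 / n.+1. *)
Lemma measurable_planeset Om : open Om ->
  measurable (planeset Om : set (measurableTypeR R * measurableTypeR R)).
Proof.
move=> oOm.
pose sq (q : rat * rat * nat) : set (R * R) :=
  [set p | `|p.1 - ratr q.1.1| < q.2.+1%:R^-1 /\ `|p.2 - ratr q.1.2| < q.2.+1%:R^-1].
pose G (q : rat * rat * nat) : set (measurableTypeR R * measurableTypeR R) :=
  if pselect (sq q `<=` planeset Om) then sq q else set0.
have -> : planeset Om = \bigcup_q G q.
  apply/seteqP; split => [[x y] Oxy|p [q _]]; last first.
    by rewrite /G; case: pselect => // sO /sO.
  have [e e0 eO] := open_cabs oOm Oxy.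
  (* Points of a square of half-side below [e / 4] differ by less than [e / 2] in each coordinate,
     hence by less than [e] in modulus. *)
  have [n ne] : exists n : nat, n.+1%:R^-1 < e / 4.
    have e40 : 0 < e / 4 by lra.
    exists (Num.truncn (e / 4)^-1); rewrite -[ltRHS]invrK ltf_pV2 ?posrE ?invr_gt0//.
    exact: truncnS_gt.
  have n0 : 0 < n.+1%:R^-1 :> R by rewrite invr_gt0.
  have [q1 xq] := exists_rat_near x n0; have [q2 yq] := exists_rat_near y n0.
  exists ((q1, q2), n) => //; rewrite /G; case: pselect => // -[] [x' y'] [/= x'q y'q].
  apply: eO; apply: le_lt_trans (cabs_le _) _; rewrite /toC/=.
  have tri (s s' q d : R) : `|s - q| < d -> `|s' - q| < d -> d < e / 4 -> `|s' - s| < e / 2.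
    by rewrite !ltr_norml => /andP[h1 h2] /andP[h3 h4] h5; apply/andP; split; lra.
  have hx := tri _ _ _ _ xq x'q ne; have hy := tri _ _ _ _ yq y'q ne.
  by lra.
apply: countable_bigcupT_measurable => // -[[q1 q2] n]; rewrite /G.
case: pselect => [sO|nsO]; last exact: measurable0.
pose I (q : rat) : set (measurableTypeR R) := [set x : R | `|x - ratr q| < n.+1%:R^-1].
have mI q : measurable (I q).
  rewrite (_ : I q = `](ratr q - n.+1%:R^-1), (ratr q + n.+1%:R^-1)[%classic)//.
  by apply/seteqP; split => x; rewrite /I/= in_itv/= ltr_distl.
rewrite /= (_ : sq _ = I q1 `*` I q2); first exact: measurableX.
by apply/seteqP; split.
Qed.

End plane_topology.

(** * Square norm on the domain bounded below by circle norms *)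

Section bergman_area.
Context {R : realType}.
Notation mu := (@lebesgue_measure R).
Implicit Types (f : cplx R -> cplx R) (a : cplx R) (Om : set (cplx R)).

Lemma circle_sqnorm_continuous f a u : (forall t, derivable f (a + cE u t) 1) ->
  continuous (fun t => cabs (f (a + cE u t)) ^+ 2).
Proof.
move=> df t.
have : cts t t (fun t => cabs (f (a + cE u t))).
  apply: cts_cabs; split => x _.
  - exact: (@rcont_cont2 _ (fun x y => complex.Re (f (a + cE x y))))
      (zcont_Re (zcont_comp (derivable_ccont (df x)) (zdiff_pol a u x))).
  - exact: (@rcont_cont2 _ (fun x y => complex.Im (f (a + cE x y))))
      (zcont_Im (zcont_comp (derivable_ccont (df x)) (zdiff_pol a u x))).
move=> /(_ t); rewrite lexx => /(_ isT) ct.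
under eq_fun do rewrite expr2.
exact: (cvgM ct ct).
Qed.

Lemma circ_sqnormE f a u : (forall t, derivable f (a + cE u t) 1) ->
  circ_sqnorm f a u = expR u ^+ 2 * rint (- pi) pi (fun t => cabs (f (a + cE u t)) ^+ 2).
Proof.
move=> df; rewrite -rintZ; last by move=> t _; exact: circle_sqnorm_continuous.
by apply: eq_rint => t _; rewrite /circ_fun cabsM cabs_cE exprMn mulrC.
Qed.

(** Extension by zero and translation by [a] turn the integral over [Om] into one over the plane; on
    the annulus, contained in [Om], the extension still is [|f|^2]. *)
Lemma bergman_area_ge Om f a (c v1 v2 : R) : open Om -> bergman_space Om f ->
  0 <= c -> v1 <= v2 ->
  (forall u t, v1 <= u <= v2 -> Om (a + cE u t)) ->
  (forall u, v1 <= u <= v2 -> c <= circ_sqnorm f a u) ->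
  c * (v2 - v1) <= Rintegral (area R) (planeset Om) (fun p => cabs (f (toC p)) ^+ 2).
Proof.
move=> oOm [hf intf] c0 v12 aOm cle.
have mO := measurable_planeset oOm.
have /integrableP[mgO _] := intf.
pose g (p : measurableTypeR R * measurableTypeR R) : \bar R := (cabs (f (toC p)) ^+ 2)%:E.
have df u t : v1 <= u <= v2 -> derivable f (a + cE u t) 1 by move=> /(aOm u t)/hf.
have mg : measurable_fun setT (g \_ (planeset Om)).
  by apply/(measurable_restrictT g mO); exact: mgO.
have g0 p : (0 <= (g \_ (planeset Om)) p)%E.
  by rewrite patchE; case: ifP => // _; rewrite lee_fin sqr_ge0.
rewrite -lee_fin /Rintegral fineK; last exact: integrable_fin_num intf.
rewrite integral_mkcond (area_translate (complex.Re a) (complex.Im a) mg g0).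
apply: (@polar_area_ge _ _ (fun u t => cabs (f (a + cE u t)) ^+ 2)) => //.
- apply: (@measurable_pmap _ _ (fun p => complex.Re a + p.1) (fun p => complex.Im a + p.2)) => //.
    exact: measurable_funD.
  exact: measurable_funD.
- by move=> u uv; apply: circle_sqnorm_continuous => t; exact: df.
- move=> u t uv.
  have E : toC (complex.Re a + expR u * cos t, complex.Im a + expR u * sin t) = a + cE u t.
    by case: (a).
  by rewrite patchE /= mem_set /g/= ?E// /planeset/= E; exact: aOm.
- by move=> u uv; rewrite -circ_sqnormE ?cle// => t; exact: df.
Qed.

End bergman_area.

(** * The kernel estimate on an annulus *)

Section bergman_estimate.
Context {R : realType}.
Implicit Types (f k : cplx R -> cplx R) (a z : cplx R) (Om : set (cplx R)).

Definition bergman_sqnorm Om f : R :=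
  Rintegral (area R) (planeset Om) (fun p => cabs (f (toC p)) ^+ 2).

Lemma bergman_sqnorm_ge0 Om f : 0 <= bergman_sqnorm Om f.
Proof. by apply: Rintegral_ge0 => p _; exact: sqr_ge0. Qed.

(** The reproducing property is applied to [k] itself. *)
Lemma reproducing_diag Om z k : bergman_reproducing_at Om z k ->
  k z = (bergman_sqnorm Om k)%:C%C.
Proof.
move=> [bk /(_ k bk) ->]; rewrite /cintegral /bergman_sqnorm.
have E w : k w * ((k w)^*)%C = (cabs (k w) ^+ 2)%:C%C.
  rewrite cabs_sqr; case: (k w) => x y; apply/eqP; rewrite eq_complex/=.
  by apply/andP; split; apply/eqP; ring.
congr (_ +i* _)%C; first by apply: eq_Rintegral => p _; rewrite E.
by rewrite /Rintegral integral0_eq// => p _; rewrite E.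
Qed.

(** If every circle in a band of logarithmic width 1 exceeded twice the square norm, the area bound
    would exceed the positive square norm itself. *)
Lemma exists_small_circle Om f a (v : R) : open Om -> bergman_space Om f ->
  0 < bergman_sqnorm Om f ->
  (forall u t, v <= u <= v + 1 -> Om (a + cE u t)) ->
  exists2 u, v <= u <= v + 1 & circ_sqnorm f a u <= 2 * bergman_sqnorm Om f.
Proof.
move=> oOm bf K0 aOm; apply: contrapT => nex.
have : 2 * bergman_sqnorm Om f * (v + 1 - v) <= bergman_sqnorm Om f.
  apply: (bergman_area_ge oOm bf) aOm _ => [||u uv].
  - by rewrite mulr_ge0// ltW.
  - by lra.
  - by rewrite leNgt; apply/negP => /ltW Su; apply: nex; exists u.
by lra.
Qed.

(** The residue is the same on all circles and by Cauchy-Schwarz bounds each [circ_sqnorm] from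
    below by [|circ|^2 / (2 pi)]; the whole logarithmic width then contributes. *)
Lemma circ_mean_le Om f a (v1 v2 : R) : open Om -> bergman_space Om f -> v1 <= v2 ->
  (forall u t, v1 <= u <= v2 -> Om (a + cE u t)) -> forall u, v1 <= u <= v2 ->
  cabs (circ f a u) ^+ 2 * (v2 - v1) <= 2 * pi * bergman_sqnorm Om f.
Proof.
move=> oOm bf v12 aOm u uv.
have pi0 := pi_gt0 R.
have df u' t : v1 <= u' <= v2 -> derivable f (a + cE u' t) 1 by move=> /(aOm u' t)/bf.1.
have cE1 u' : v1 <= u' <= v2 -> circ f a v1 = circ f a u'.
  move=> /andP[h1 h2]; apply: circ_indep => // x t /andP[h3 h4].
  by apply/derivable_cdiff/df; rewrite h3 (le_trans h4).
rewrite -cE1//.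
rewrite -ler_pdivrMl; last by lra.
rewrite mulrA; apply: (bergman_area_ge oOm bf _ v12 aOm) => [|x xv].
  by rewrite mulr_ge0 ?sqr_ge0// invr_ge0; lra.
rewrite ler_pdivrMl; last by lra.
by rewrite (cE1 _ xv); apply: circ_sqr_le => t; exact: df.
Qed.

Lemma bergman_annulus_bound Om a (v1 p v2 : R) k : open Om ->
  bergman_reproducing_at Om (a + cE p 0) k ->
  (forall u t, v1 <= u <= v2 -> Om (a + cE u t)) ->
  2 <= v2 - p -> 2 <= p - v1 ->
  expR p * Num.sqrt (2 * pi * complex.Re (k (a + cE p 0))) <=
    (Num.sqrt (v2 - v1))^-1 + 3 * ((v2 - p)^-1 + (p - v1)^-1).
Proof.
move=> oOm rk aOm X2 Y2; have bk := rk.1.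
have pi0 := pi_gt0 R.
have kz := reproducing_diag rk; rewrite kz /=.
set K := bergman_sqnorm Om k in kz *.
have RHS0 : 0 <= (Num.sqrt (v2 - v1))^-1 + 3 * ((v2 - p)^-1 + (p - v1)^-1).
  rewrite addr_ge0 ?invr_ge0 ?sqrtr_ge0// mulr_ge0// addr_ge0// invr_ge0; lra.
have [X0 Y0 T0] : [/\ 0 < v2 - p, 0 < p - v1 & 0 < v2 - v1] by split; lra.
have := bergman_sqnorm_ge0 Om k; rewrite -/K le_eqVlt => /predU1P[<-|K0].
  by rewrite mulr0 sqrtr0 mulr0.
set A := Num.sqrt (2 * pi * K).
have A2 : A ^+ 2 = 2 * pi * K by rewrite sqr_sqrtr// mulr_ge0 ?(ltW K0)//; lra.
have A0 : 0 < A by rewrite sqrtr_gt0 mulr_gt0// ; lra.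
have [u2 /andP[u21 u22] S2] : exists2 u, v2 - 1 <= u <= v2 - 1 + 1 &
    circ_sqnorm k a u <= 2 * K.
  by apply: exists_small_circle => // u t uv; apply: aOm; clear -uv X2 Y2; lra.
have [u1 /andP[u11 u12] S1] : exists2 u, v1 <= u <= v1 + 1 & circ_sqnorm k a u <= 2 * K.
  by apply: exists_small_circle => // u t uv; apply: aOm; clear -uv X2 Y2; lra.
(* The factor [sqrt 2] from the small circles is rounded up to [3 / 2]. *)
have sq32 (S : R) : S <= 2 * K -> Num.sqrt (2 * pi * S) <= 3 / 2 * A.
  move=> SK; rewrite -[leRHS]ger0_norm; last by rewrite mulr_ge0// ltW.
  rewrite -sqrtr_sqr ler_wsqrtr// exprMn A2 (_ : _ * (2 * pi * K) = 2 * pi * ((3 / 2) ^+ 2 * K));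
    last by ring.
  rewrite ler_wpM2l//; first by clear -pi0; lra.
  by apply: le_trans SK _; rewrite ler_pM2r// expr2; clear; lra.
have m_le : cabs (circ k a u1) <= A / Num.sqrt (v2 - v1).
  rewrite ler_pdivlMr ?sqrtr_gt0//.
  rewrite -(@ler_pXn2r _ 2)// ?nnegrE ?mulr_ge0 ?sqrtr_ge0// exprMn A2 (sqr_sqrtr (ltW T0)).
  apply: (circ_mean_le oOm bk (ltW _) aOm); clear -u11 u12 X2 Y2; lra.
(* The quotient is [1 / (expR (u2 - p) - 1)], at most [1 / (u2 - p)]. As [u2 >= v2 - 1] and the gap
   is at least 2, losing one unit costs at most a factor 2; together with [3 / 2] this makes the
   final 3. *)
have f2 : expR p / (expR u2 - expR p) <= 2 / (v2 - p).
  have e0 := expR_gt0 p; have e1 : expR p < expR u2 by rewrite ltr_expR; clear -u21 u11 u12 X2 Y2; lra.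
  rewrite ler_pdivrMr ?subr_gt0// mulrAC ler_pdivlMr//.
  have -> : expR u2 = expR p * expR (u2 - p) by rewrite -expRD; congr expR; ring.
  have := expR_ge1Dx (u2 - p) => h.
  have : (v2 - p) / 2 <= expR (u2 - p) - 1 by clear -h u21 X2; lra.
  by clear -e0; nra.
have f1 : expR u1 / (expR p - expR u1) <= 2 / (p - v1).
  have e0 := expR_gt0 u1; have e1 : expR u1 < expR p by rewrite ltr_expR; clear -u21 u11 u12 X2 Y2; lra.
  rewrite ler_pdivrMr ?subr_gt0// mulrAC ler_pdivlMr//.
  have -> : expR p = expR u1 * expR (p - u1) by rewrite -expRD; congr expR; ring.
  have := expR_ge1Dx (p - u1) => h.
  have : (p - v1) / 2 <= expR (p - u1) - 1 by clear -h u12 Y2; lra.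
  by clear -e0; nra.
have := @annulus_pointwise _ k a u1 p u2.
have -> : cabs (k (a + cE p 0)) = K by rewrite kz cabs_real gtr0_norm.
have u1p : u1 < p by clear -u12 Y2; lra.
have pu2 : p < u2 by clear -u21 X2; lra.
move=> /(_ u1p pu2) h.
have {h} h : 2 * pi * (expR p * K) <= A / Num.sqrt (v2 - v1) +
    2 / (v2 - p) * (3 / 2 * A) + 2 / (p - v1) * (3 / 2 * A).
  apply: (le_trans (h _)).
    by move=> u t uv; apply: bk.1; apply: aOm; clear -uv u11 u22; lra.
  apply: lerD; first apply: lerD => //.
  - apply: ler_pM => //; first by rewrite divr_ge0 ?expR_ge0// subr_ge0 ler_expR ltW.
    exact: sq32.
  - apply: ler_pM => //; first by rewrite divr_ge0 ?expR_ge0// subr_ge0 ler_expR ltW.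
    exact: sq32.
rewrite -(ler_pM2r A0) -mulrA -expr2 A2.
rewrite (_ : expR p * (2 * pi * K) = 2 * pi * (expR p * K)); last by ring.
by apply: le_trans h _; rewrite le_eqVlt; apply/orP; left; apply/eqP; field; rewrite !gt_eqF ?sqrtr_gt0.
Qed.

End bergman_estimate.

(** * Position of a domain relative to an annulus missed by its boundary *)

Section annulus_topology.
Context {R : realType}.
Implicit Types (a z w : cplx R) (Om : set (cplx R)).

Lemma circle_continuous a u : continuous (fun t : R => a + cE u t : cplx R).
Proof.
move=> t; apply/cvg_ballP => e e0.
have /nbhs_cabs[d d0 dA] : nbhs (a + cE u t) (ball (a + cE u t) e) by exact: nbhsx_ballx.
have [h h0 hd] := zcont_comp (F := fun z => z) (fun e e0 => ex_intro2 _ _ e e0 (fun w h => h))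
  (zdiff_pol a u t) (divr_gt0 d0 (ltr0Sn _ 1)).
near=> x; apply: dA.
apply: le_lt_trans (hd u x _ _) _; [by rewrite subrr normr0 ltW| |lra].
by rewrite distrC; near: x; exact: cvgr_dist_le.
Unshelve. all: by end_near. Qed.

Lemma connected_real : connected [set: R].
Proof. by apply/connected_intervalP. Qed.

(** The angles whose point lies in [Om] form an open set, and a closed one because the circle misses
    the boundary; the real line is connected. *)
Lemma circle_subset Om a u t0 : open Om ->
  (forall t, ~ boundary Om (a + cE u t)) -> Om (a + cE u t0) ->
  forall t, Om (a + cE u t).
Proof.
move=> oOm nb Ot0 t.
pose B := (fun t : R => a + cE u t) @^-1` Om.
have oB : open B by apply: open_comp oOm => x _; exact: circle_continuous.
have cB : closed B.
  rewrite (_ : B = (fun t : R => a + cE u t) @^-1` closure Om); last first.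
    apply/seteqP; split => x; rewrite /B/=; first exact: (@subset_closure _ Om).
    move=> cx; apply: contrapT => nO; apply: (nb x); split => // /interior_subset; exact: nO.
  by apply: closed_comp; [move=> x _; exact: circle_continuous|exact: closed_closure].
have BT : B = setT.
  apply: connected_real; first by exists t0.
  - by exists B => //; rewrite setTI.
  - by exists B => //; rewrite setTI.
by have : B t by rewrite BT.
Qed.

Lemma cabs_continuous_at a z (e : R) : 0 < e ->
  nbhs z [set w | `|cabs (w - a) - cabs (z - a)| < e].
Proof.
move=> e0; apply/nbhs_cabs; exists e => // w wz /=.
have h1 := cabsD (w - z) (z - a); have h2 := cabsD (z - w) (w - a).
rewrite [cabs (z - w)]cabs_dist in h2.
rewrite (_ : w - z + (z - a) = w - a) in h1; last by ring.
rewrite (_ : z - w + (w - a) = z - a) in h2; last by ring.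
by rewrite ltr_norml; apply/andP; split; lra.
Qed.

Lemma open_disc a (r : R) : open [set z : cplx R | cabs (z - a) < r].
Proof.
rewrite openE => z /= zr; have e0 : 0 < r - cabs (z - a) by lra.
apply: filterS (cabs_continuous_at a z e0) => w /=.
by rewrite ltr_norml => /andP[? ?]; lra.
Qed.

Lemma closed_disc a (r : R) : closed [set z : cplx R | cabs (z - a) <= r].
Proof.
rewrite (_ : mkset _ = ~` [set z : cplx R | r < cabs (z - a)]); last first.
  by apply/seteqP; split => z /=; rewrite leNgt => /negP.
apply: open_closedC; rewrite openE => z /= zr; have e0 : 0 < cabs (z - a) - r by lra.
apply: filterS (cabs_continuous_at a z e0) => w /=.
by rewrite ltr_norml => /andP[? ?]; lra.
Qed.

Lemma boundary_near Om a (e : R) : boundary Om a -> 0 < e ->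
  exists2 z, Om z & cabs (z - a) < e.
Proof.
move=> [ca _] e0.
have /ca[z [Oz ze]] : nbhs a [set w | cabs (w - a) < e].
  by apply/nbhs_cabs; exists e.
by exists z.
Qed.

Lemma cE_polar (z : cplx R) : z != 0 -> exists t, z = cE (ln (cabs z)) t.
Proof.
case: z => x y z0; set z := (x +i* y)%C in z0 *.
have r0 : 0 < cabs z by rewrite cabs_gt0.
have rr : cabs z ^+ 2 = x ^+ 2 + y ^+ 2 by rewrite cabs_sqr.
pose c := x / cabs z; pose s := y / cabs z.
have cs : c ^+ 2 + s ^+ 2 = 1.
  by rewrite /c /s !exprMn exprVn -mulrDl -rr mulfV// sqrf_eq0 gt_eqF.
have c1 : -1 <= c <= 1.
  by rewrite -ler_norml -(@ler_pXn2r _ 2)// ?nnegrE// real_normK ?num_real// expr1n -cs lerDl sqr_ge0.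
have s2 : sin (acos c) = `|s|.
  by rewrite sin_acos// -cs addrAC subrr add0r sqrtr_sqr.
have E t : cos t = c -> sin t = s -> z = cE (ln (cabs z)) t.
  by move=> ct st; rewrite /cE ct st lnK ?posrE// /c /s ![_ * (_ / _)]mulrC !divfK// gt_eqF.
have [s0|s0] := leP 0 s.
  by exists (acos c); apply: E; rewrite ?acosK// s2 ger0_norm.
by exists (- acos c); apply: E; rewrite ?cosN ?acosK// sinN s2 ltr0_norm// opprK.
Qed.

(** If some circle of the annulus misses [Om], the part of [Om] inside it is open and closed in
    [Om], and nonempty since [a] is a boundary point; so it is all of [Om]. *)
Lemma annulus_dichotomy Om a (v1 v2 : R) : open Om -> connected Om -> boundary Om a ->
  (forall z, boundary Om z -> ~~ (expR v1 <= cabs (z - a) <= expR v2)) ->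
  (forall u t, v1 <= u <= v2 -> Om (a + cE u t)) \/
  (forall z, Om z -> cabs (z - a) < expR v2).
Proof.
move=> oOm cOm ba nb.
case: (pselect (forall z, Om z -> cabs (z - a) < expR v2)) => [|nO]; first by right.
left => u t /andP[uv1 uv2].
have nbu t' : ~ boundary Om (a + cE u t').
  move=> /nb/negP; apply; rewrite addrC addKr cabs_cE.
  by rewrite !ler_expR uv1.
have [t0 Ot0] : exists t0, Om (a + cE u t0); last exact: circle_subset Ot0 t.
apply: contrapT => nex.
have nz z : Om z -> cabs (z - a) != expR u.
  move=> Oz; apply/eqP => zu; apply: nex.
  have [|t' Et'] := @cE_polar (z - a); first by rewrite -cabs_gt0 zu expR_gt0.
  by exists t'; move: Et'; rewrite zu expRK => <-; rewrite addrC subrK.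
pose B := Om `&` [set z | cabs (z - a) < expR u].
have : B = Om.
  apply: cOm.
  - have [z Oz zu] := boundary_near ba (expR_gt0 u).
    by exists z.
  - by exists [set z | cabs (z - a) < expR u] => //; exact: open_disc.
  - exists [set z | cabs (z - a) <= expR u]; first exact: closed_disc.
    apply/seteqP; split => z [Oz /= zu]; split => //=; first exact: ltW.
    by rewrite lt_neqAle nz.
move=> BO; apply: nO => z; rewrite -BO => -[_ /= zu].
by apply: lt_le_trans zu _; rewrite ler_expR.
Qed.

(** The boundary point makes the set of distances nonempty, so that [inf] is a true infimum and no
    default value. *)
Lemma has_inf_dist Om z a : boundary Om a -> has_inf [set cabs (z - w) | w in boundary Om].
Proof. by move=> ba; split; [exists (cabs (z - a)), a|exists 0 => _ [w _ <-]]. Qed.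

Lemma dist_boundary_le Om z a : boundary Om a -> dist_boundary Om z <= cabs (z - a).
Proof. by move=> ba; apply: ge_inf; [case: (has_inf_dist z ba)|exists a]. Qed.

Lemma dist_boundary_ge Om z a (d : R) : boundary Om a ->
  (forall w, boundary Om w -> d <= cabs (z - w)) -> d <= dist_boundary Om z.
Proof.
move=> ba dw; apply: lb_le_inf; first by case: (has_inf_dist z ba).
by move=> _ [w bw <-]; exact: dw.
Qed.

(** Common core of the three parts: [phi] is the constant 1, a logarithm or an iterated logarithm.
    Only its bound [N] on distances between [expR p / 2] and [expR p] matters, since the distance of
    the test point to the boundary lies there. *)
Lemma boundary_gap_bound Om K a (v1 p v2 c N eps : R) (phi : R -> R) :
  open Om -> connected Om -> bergman_kernel_diag Om K -> boundary Om a ->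
  (forall z, boundary Om z -> ~~ (expR v1 <= cabs (z - a) <= expR v2)) ->
  ~ (forall z, Om z -> cabs (z - a) < expR v2) ->
  (forall z, Om z -> dist_boundary Om z < eps ->
     c / (dist_boundary Om z ^+ 2 * phi (dist_boundary Om z)) <= K z) ->
  0 < c -> expR p < eps ->
  (forall d, expR p / 2 <= d <= expR p -> 0 < phi d <= N) ->
  2 <= v2 - p -> 2 <= p - v1 ->
  Num.sqrt (2 * pi * c / N) <=
    (Num.sqrt (v2 - v1))^-1 + 3 * ((v2 - p)^-1 + (p - v1)^-1).
Proof.
move=> oOm cOm kd ba nb nO lowK c0 pe phiN X2 Y2.
have [aOm|//] := annulus_dichotomy oOm cOm ba nb.
pose z := a + cE p 0.
have Oz : Om z by apply: aOm; lra.
have [k [rk KE]] := kd z Oz.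
have ep := expR_gt0 p; have pi0 := pi_gt0 R.
have za : cabs (z - a) = expR p by rewrite /z addrC addKr cabs_cE.
(* Gaps of at least 2 and [exp x >= 1 + x] separate the radii by factors of 3, enough for the
   distance bound [expR p / 2]. *)
have e1 : 3 * expR v1 <= expR p.
  have h := expR_ge1Dx (p - v1).
  rewrite (_ : expR p = expR v1 * expR (p - v1)); last by rewrite -expRD addrC subrK.
  by rewrite mulrC ler_wpM2l ?expR_ge0//; lra.
have e2 : 3 * expR p <= expR v2.
  have h := expR_ge1Dx (v2 - p).
  rewrite (_ : expR v2 = expR p * expR (v2 - p)); last by rewrite -expRD addrC subrK.
  by rewrite mulrC ler_wpM2l ?expR_ge0//; lra.
have d1 : dist_boundary Om z <= expR p by rewrite -za; exact: dist_boundary_le.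
have d2 : expR p / 2 <= dist_boundary Om z.
  apply: (dist_boundary_ge ba) => w bw.
  have := nb w bw; rewrite negb_and -!ltNge => /orP[w1|w2].
    have := @lt_cabs_distD _ (w - a) (z - a) _ _ (ltW w1) (lexx _).
    rewrite (_ : z - a - (w - a) = z - w); last by ring.
    by rewrite za; clear -e1 e2 ep; have := expR_gt0 v1; lra.
  have := @lt_cabs_distD _ (z - a) (w - a) _ _ (lexx _) (ltW w2).
  rewrite (_ : w - a - (z - a) = w - z); last by ring.
  by rewrite za cabs_dist; clear -e1 e2 ep; lra.
set d := dist_boundary Om z in d1 d2.
have /andP[phi0 phiN'] : 0 < phi d <= N by apply: phiN; rewrite d2.
have Kz : c / (d ^+ 2 * phi d) <= K z by apply: lowK => //; exact: le_lt_trans d1 pe.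
have N0 : 0 < N by exact: lt_le_trans phi0 phiN'.
have d0 : 0 < d by apply: lt_le_trans d2; rewrite divr_gt0.
have KN : c / N <= expR p ^+ 2 * K z.
  apply: (@le_trans _ _ (expR p ^+ 2 * (c / (d ^+ 2 * phi d)))); last first.
    by rewrite ler_wpM2l// sqr_ge0.
  rewrite mulrA ler_pdivrMr// mulrAC ler_pdivlMr ?mulr_gt0 ?exprn_gt0//.
  rewrite (_ : expR p ^+ 2 * c * N = c * (expR p ^+ 2 * N)); last by ring.
  rewrite ler_pM2l//; apply: ler_pM => //; [exact: sqr_ge0|exact: ltW|].
  by rewrite ler_pXn2r ?nnegrE// ltW.
apply: le_trans (bergman_annulus_bound oOm rk aOm X2 Y2).
rewrite -/z -KE -[expR p](ger0_norm (ltW ep)) -sqrtr_sqr -sqrtrM ?sqr_ge0//.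
apply: ler_wsqrtr.
rewrite (_ : expR p ^+ 2 * (2 * pi * K z) = 2 * pi * (expR p ^+ 2 * K z)); last by ring.
by rewrite -mulrA ler_wpM2l//; lra.
Qed.

End annulus_topology.

(** * Choice of the radii and contradiction with the kernel bound *)

Section asymptotics.
Context {R : realType}.
Implicit Types (a z w : cplx R) (Om : set (cplx R)) (K : cplx R -> R).

(** Two points of [Om] at distance [e / 2] do not fit into a disc of radius [e / 8]. *)
Lemma open_not_small Om : open Om -> Om !=set0 -> exists2 d : R, 0 < d &
  forall a (r : R), r <= d -> ~ (forall z, Om z -> cabs (z - a) < r).
Proof.
move=> oOm [z1 Oz1]; have [e e0 eO] := open_cabs oOm Oz1.
exists (e / 8); first by lra.
move=> a r re h; pose z2 : cplx R := z1 + (e / 2)%:C%C.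
have h12 : cabs (z2 - z1) = e / 2.
  by rewrite /z2 addrC addKr cabs_real ger0_norm//; lra.
have h1 := h z1 Oz1; have h2 : cabs (z2 - a) < r by apply/h/eO; lra.
have := cabsB (z2 - a) (z1 - a).
by rewrite (_ : z2 - a - (z1 - a) = z2 - z1); [lra|ring].
Qed.

(** Limits at infinity are taken as continuity at 0 in the variable [y], the inverse square root of
    the large parameter. *)
Lemma small_near0 (f : R -> R) (c : R) : {for 0, continuous f} -> f 0 < c ->
  exists2 y0 : R, 0 < y0 & forall y, 0 < y -> y < y0 -> f y < c.
Proof.
move=> cf fc; have : \forall y \near (0 : R), f y < c by exact: (cvgr_lt (f 0) cf).
move=> /nbhs_ballP[y0 /= y00 h]; exists y0 => // y y1 y2; apply: h.
by rewrite -ball_normE /ball_/= sub0r normrN gtr0_norm.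
Qed.

Lemma exists_large (s : seq R) : exists2 L : R, 1 <= L & all (fun x => x <= L) s.
Proof.
elim: s => [|x s [L L1 sL]]; first by exists 1.
exists (Num.max x L); first by rewrite le_max L1 orbT.
by rewrite /= le_max lexx/=; apply: sub_all sL => y yL; rewrite le_max yL orbT.
Qed.

Lemma ln_half_bounds (p d : R) : expR p / 2 <= d <= expR p -> p - 1 <= ln d <= p.
Proof.
move=> /andP[d1 d2]; have ep := expR_gt0 p.
have d0 : 0 < d by lra.
apply/andP; split; rewrite -ler_expR lnK ?posrE//.
apply: le_trans d1; rewrite expRB; apply: ler_wpM2l; first exact: ltW.
by rewrite lef_pV2 ?posrE ?expR_gt0//; have := expR_ge1Dx (1 : R); lra.
Qed.

Lemma inv_sqrt_lt (L y0 : R) : 0 < y0 -> y0^-1 ^+ 2 < L -> (Num.sqrt L)^-1 < y0.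
Proof.
move=> y00 h; have L0 : 0 < L by apply: le_lt_trans h; exact: sqr_ge0.
rewrite -[ltRHS]invrK ltf_pV2 ?posrE ?sqrtr_gt0 ?invr_gt0//.
rewrite -(@ltr_pXn2r _ 2)// ?nnegrE ?sqrtr_ge0 ?invr_ge0 ?(ltW y00)//.
by rewrite (sqr_sqrtr (ltW L0)).
Qed.

Lemma condU1_of_kernel Om K (M g : R) : open Om -> connected Om -> Om !=set0 ->
  bergman_kernel_diag Om K -> 0 < M -> 0 < g -> 1 < 2 * pi * M * g ->
  near_boundary Om
    (fun z => M / (dist_boundary Om z ^+ 2 * ln (dist_boundary Om z)^-1) <= K z) ->
  condU1 (1 + g) (boundary Om).
Proof.
move=> oOm cOm Om0 kd M0 g0 Mg [eps [eps0 lowK]].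
have pi0 := pi_gt0 R.
have [d0 d00 nsmall] := open_not_small oOm Om0.
(* [e] must leave both gaps [e L] and [(g - e) L] of order [L], and keep the limiting inequality
   [2 pi M <= (1 + e) / g] false. *)
have [e [e0 eg eM]] : exists e, [/\ 0 < e, 0 < g - e & 1 + e < 2 * pi * M * g].
  exists (Num.min g (2 * pi * M * g - 1) / 2).
  by case: (leP g) => h; split; lra.
pose b := (Num.sqrt g)^-1; pose D := 3 * (e^-1 + (g - e)^-1).
(* With [y = 1 / sqrt L], this is the squared right-hand side of the gap bound times
   [1 + (1 + e) * L]; its value at 0 is [(1 + e) / g]. *)
pose f y := (y * y + (1 + e)) * ((b + D * y) * (b + D * y)).
have [||y0 y00 fy] := @small_near0 f (2 * pi * M).
- have c1 : {for 0, continuous (fun y : R => b + D * y)}.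
    by apply: cvgD; [exact: cvg_cst|apply: cvgM; [exact: cvg_cst|exact: cvg_id]].
  apply: cvgM; last exact: (cvgM c1 c1).
  by apply: cvgD; [exact: (cvgM cvg_id cvg_id)|exact: cvg_cst].
- rewrite /f !mulr0 add0r addr0 -expr2 exprVn (sqr_sqrtr (ltW g0)).
  by rewrite ltr_pdivrMr.
(* In order: [y < y0], both gaps at least 2, the test point within [eps] of the boundary, and discs
   of radius [r] too small to contain [Om]. *)
have [L0 L01 /=/and5P[L0y L0e L0g L0eps /andP[L0d _]]] :=
  exists_large [:: y0^-1 ^+ 2; 2 / e; 2 / (g - e); - ln eps; - ln d0].
exists 1, (expR (- L0)); split => //; split.
  by rewrite expR_gt0/= expR_lt1; lra.
move=> a ba r /andP[r0 rL0]; pose L := - ln r.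
have rE : r = expR (- L) by rewrite opprK lnK.
have LL0 : L0 < L by move: rL0; rewrite rE ltr_expR; lra.
have Lp : 0 < L by lra.
apply: contrapT => nex.
have hE : 1 * h1 (1 + g) r = expR (- ((1 + g) * L)).
  by rewrite mul1r /h1 /powR gt_eqF// /L; congr expR; ring.
have eL : 2 <= e * L.
  by rewrite mulrC -ler_pdivrMr//; lra.
have gL : 2 <= (g - e) * L.
  by rewrite mulrC -ler_pdivrMr//; lra.
have := @boundary_gap_bound _ Om K a (- ((1 + g) * L)) (- ((1 + e) * L)) (- L) M
  (1 + (1 + e) * L) eps (fun d => ln d^-1) oOm cOm kd ba.
move=> /(_ _ _ lowK M0) H.
have {H} : Num.sqrt (2 * pi * M / (1 + (1 + e) * L)) <=
    (Num.sqrt (g * L))^-1 + 3 * ((e * L)^-1 + ((g - e) * L)^-1).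
  rewrite (_ : g * L = - L - - ((1 + g) * L)); last by ring.
  rewrite (_ : (g - e) * L = - ((1 + e) * L) - - ((1 + g) * L)); last by ring.
  rewrite (_ : e * L = - L - - ((1 + e) * L)); last by ring.
  apply: H.
  - move=> z bz; apply/negP => hz; apply: nex; exists z; split => //.
    by rewrite hE rE.
  - apply: nsmall; rewrite -(lnK (x := d0))// ler_expR; lra.
  - by rewrite -(lnK (x := eps))// ltr_expR; nra.
  - move=> d dp; have /andP[l1 l2] := ln_half_bounds dp.
    have dpos : 0 < d by move: dp => /andP[dp _]; have := expR_gt0 (- ((1 + e) * L)); lra.
    by rewrite lnV ?posrE//; nra.
  - by nra.
  - by nra.
pose y := (Num.sqrt L)^-1.
have y1 : 0 < y by rewrite invr_gt0 sqrtr_gt0.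
have yL : L^-1 = y * y by rewrite -expr2 exprVn (sqr_sqrtr (ltW Lp)).
have -> : (Num.sqrt (g * L))^-1 + 3 * ((e * L)^-1 + ((g - e) * L)^-1) = y * (b + D * y).
  by rewrite (sqrtrM _ (ltW g0)) !invfM yL -/y -/b /D; ring.
move=> H.
have A0 : 0 <= 2 * pi * M / (1 + (1 + e) * L).
  by rewrite divr_ge0//; [rewrite !mulr_ge0// ltW|nra].
have {}H : 2 * pi * M / (1 + (1 + e) * L) <= (y * (b + D * y)) ^+ 2.
  rewrite -(sqr_sqrtr A0) ler_pXn2r ?nnegrE ?sqrtr_ge0//.
  exact: le_trans (sqrtr_ge0 _) H.
have yy0 : y < y0 by apply: inv_sqrt_lt => //; lra.
have := fy y y1 yy0; apply/negP; rewrite -leNgt.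
move: H; rewrite ler_pdivrMr; last by nra.
move=> /le_trans; apply; rewrite /f.
have LE : L = (y * y)^-1 by rewrite -yL invrK.
by rewrite LE le_eqVlt; apply/orP; left; apply/eqP; field; rewrite gt_eqF.
Qed.

Lemma condU2_of_kernel Om K (c : R) : open Om -> connected Om -> Om !=set0 ->
  bergman_kernel_diag Om K -> 0 < c ->
  near_boundary Om
    (fun z => c / (dist_boundary Om z ^+ 2 * ln (ln (dist_boundary Om z)^-1)) <= K z) ->
  condU2 (4 / (pi * c)) (boundary Om).
Proof.
move=> oOm cOm Om0 kd c0 [eps [eps0 lowK]].
have pi0 := pi_gt0 R.
have pc0 : 0 < pi * c by rewrite mulr_gt0.
have [d0 d00 nsmall] := open_not_small oOm Om0.
(* The limiting inequality is [sqrt (pi c) <= 1 / sqrt be]; the choice [4 / (pi * c)] makes the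
   right side half of the left. *)
have [be [be0 beE]] : exists be, 0 < be /\ be = 4 / (pi * c).
  by exists (4 / (pi * c)); split => //; rewrite divr_gt0.
rewrite -beE.
pose b := (Num.sqrt be)^-1.
have bE : b < Num.sqrt (pi * c).
  rewrite /b -sqrtrV ?(ltW be0)// ltr_sqrt// beE invf_div; lra.
(* The test circle sits logarithmically midway, so both gaps are [be * l / 2] and the second term is
   [3 * (4 / (be * l))]. *)
pose f y := b + 12 / be * y.
have [||y0 y00 fy] := @small_near0 f (Num.sqrt (pi * c)).
- by apply: cvgD; [exact: cvg_cst|apply: cvgM; [exact: cvg_cst|exact: cvg_id]].
- by rewrite /f mulr0 addr0.
(* The first two bounds act on [l = ln L]: they give [y < y0] and gaps at least 2. The third makes
   [ln (1 / d)] at most [L ^+ 2], so that its logarithm is at most [2 * l]. *)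
have [L0 L01 /=/and5P[L0y L0e L0g L0eps /andP[L0d _]]] :=
  exists_large [:: expR (y0^-1 ^+ 2); expR (4 / be); 2 + be / 2; - ln eps; - ln d0].
exists 1, (expR (- L0)); split => //; split.
  by rewrite expR_gt0/= expR_lt1; lra.
move=> a ba r /andP[r0 rL0]; pose L := - ln r.
have rE : r = expR (- L) by rewrite opprK lnK.
have LL0 : L0 < L by move: rL0; rewrite rE ltr_expR; lra.
have Lp : 0 < L by lra.
pose l := ln L.
have lE : expR l = L by rewrite lnK.
have ly : y0^-1 ^+ 2 < l by rewrite -ltr_expR lE; lra.
have lb : 4 / be <= l by rewrite -ler_expR lE; lra.
have l0 : 0 < l by apply: le_lt_trans ly; exact: sqr_ge0.
have lL : l <= L by have := expR_ge1Dx l; rewrite lE; lra.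
have bl : 4 <= be * l by rewrite mulrC -ler_pdivrMr.
apply: contrapT => nex.
have hE : 1 * h2 be r = expR (- L - be * l).
  rewrite mul1r /h2 -/L /powR gt_eqF// {1}rE -expRD; congr expR.
  by rewrite /l; ring.
have := @boundary_gap_bound _ Om K a (- L - be * l) (- L - be * l / 2) (- L) c
  (2 * l) eps (fun d => ln (ln d^-1)) oOm cOm kd ba.
move=> /(_ _ _ lowK c0) H.
have {H} : Num.sqrt (2 * pi * c / (2 * l)) <=
    (Num.sqrt (be * l))^-1 + 3 * ((be * l / 2)^-1 + (be * l / 2)^-1).
  rewrite {1}(_ : be * l = - L - (- L - be * l)); last by ring.
  rewrite {1}(_ : be * l / 2 = - L - (- L - be * l / 2)); last by field.
  rewrite {2}(_ : be * l / 2 = - L - be * l / 2 - (- L - be * l)); last by field.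
  apply: H.
  - move=> z bz; apply/negP => hz; apply: nex; exists z; split => //.
    by rewrite hE; move: hz; rewrite -rE.
  - by apply: nsmall; rewrite -(lnK (x := d0))// ler_expR; lra.
  - by rewrite -(lnK (x := eps))// ltr_expR; lra.
  - move=> d dp; have /andP[l1 l2] := ln_half_bounds dp.
    have dpos : 0 < d.
      by move: dp => /andP[dp _]; have := expR_gt0 (- L - be * l / 2); lra.
    rewrite lnV ?posrE//; apply/andP; split.
      by rewrite ln_gt0//; lra.
    rewrite -ler_expR lnK ?posrE; last by lra.
    rewrite mulr_natl mulr2n expRD lE.
    have : be / 2 * l <= be / 2 * L by rewrite ler_wpM2l//; lra.
    have : (2 + be / 2) * L <= L * L by rewrite ler_wpM2r//; lra.
    by lra.
  - by lra.
  - by lra.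
pose y := (Num.sqrt l)^-1.
have y1 : 0 < y by rewrite invr_gt0 sqrtr_gt0.
have yl : l^-1 = y * y by rewrite -expr2 exprVn (sqr_sqrtr (ltW l0)).
have -> : (Num.sqrt (be * l))^-1 + 3 * ((be * l / 2)^-1 + (be * l / 2)^-1) = f y * y.
  by rewrite (sqrtrM _ (ltW be0)) !invfM yl -/y -/b /f invrK; ring.
have -> : 2 * pi * c / (2 * l) = pi * c / l by field; rewrite gt_eqF.
rewrite (sqrtrM _ (ltW pc0)) (sqrtrV (ltW l0)) -/y ler_pM2r//.
apply/negP; rewrite -ltNge; apply: fy => //.
exact: inv_sqrt_lt.
Qed.

(** All radii below the diameter count here, not only small ones, so the large parameter is the
    logarithmic width [2 * L] of a fixed-ratio annulus. Boundedness gives [r < 2 * M], and so a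
    single [L] brings every test point within [eps] of the boundary. *)
Lemma uniformly_perfect_of_kernel Om K (c : R) : open Om -> connected Om -> Om !=set0 ->
  bergman_kernel_diag Om K -> bounded_cset Om -> 0 < c ->
  near_boundary Om (fun z => c / dist_boundary Om z ^+ 2 <= K z) ->
  uniformly_perfect (boundary Om).
Proof.
move=> oOm cOm [z1 Oz1] kd [M OM] c0 [eps [eps0 lowK]].
have pi0 := pi_gt0 R.
have M0 : 0 <= M by apply: le_trans (OM _ Oz1).
have bM z : boundary Om z -> cabs z <= M.
  move=> [cz _]; rewrite -(subr0 z).
  have : closure Om `<=` closure [set z : cplx R | cabs (z - 0) <= M].
    by apply: closure_subset => w Ow /=; rewrite subr0; exact: OM.
  by move=> /(_ z cz) /closed_disc.
pose f (y : R) := (Num.sqrt 2)^-1 * y + 6 * (y * y).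
have A0 : 0 < Num.sqrt (2 * pi * c) by rewrite sqrtr_gt0 !mulr_gt0.
have [||y0 y00 fy] := @small_near0 f (Num.sqrt (2 * pi * c)).
- apply: cvgD; apply: cvgM; [exact: cvg_cst|exact: cvg_id|exact: cvg_cst|].
  exact: (cvgM cvg_id cvg_id).
- by rewrite /f !mulr0 addr0.
(* In order: [y < y0] for [y = 1 / sqrt L], gaps at least 2, and [r * expR (- L) < eps] for every
   [r < 2 * M]. *)
have [L L1 /=/and4P[Ly L2 Leps _]] :=
  exists_large [:: y0^-1 ^+ 2 + 1; 2; ln ((2 * M + 1) / eps)].
have C1 : expR (- (2 * L)) <= 2^-1.
  rewrite expRN lef_pV2 ?posrE ?expR_gt0//.
  by have := expR_ge1Dx (2 * L); lra.
exists (expR (- (2 * L))); split; first by rewrite expR_gt0/=; lra.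
move=> a ba r r0 rdiam.
apply: contrapT => nex.
have r2M : r < 2 * M.
  rewrite -lte_fin; apply: lt_le_trans rdiam _.
  apply: ge_ereal_sup => _ [x bx [y by_ <-]]; rewrite lee_fin.
  apply: le_trans (cabsB _ _) _.
  by have := bM x bx; have := bM y by_; lra.
have rE : expR (ln r) = r by rewrite lnK.
have sE : expR (ln r - 2 * L) = expR (- (2 * L)) * r by rewrite expRD rE mulrC.
have nb z : boundary Om z -> ~~ (expR (ln r - 2 * L) <= cabs (z - a) <= expR (ln r)).
  move=> bz; apply/negP => hz; apply: nex; exists z; split => //.
  by rewrite -sE; move: hz; rewrite rE.
(* If [Om] lay in the disc of radius [r], its boundary, which misses the annulus, would lie in the
   disc of radius [expR (- (2 * L)) * r <= r / 2] and have diameter at most [r]. *)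
have big : ~ (forall z, Om z -> cabs (z - a) < expR (ln r)).
  move=> Or.
  have bs z : boundary Om z -> cabs (z - a) <= expR (- (2 * L)) * r.
    move=> bz; have := nb z bz; rewrite negb_and -!ltNge sE => /orP[/ltW//|].
    have : closure Om `<=` closure [set z : cplx R | cabs (z - a) <= expR (ln r)].
      by apply: closure_subset => w Ow /=; exact/ltW/Or.
    by move=> /(_ z bz.1) /closed_disc /=; rewrite leNgt => /negP.
  have : (diam (boundary Om) <= r%:E)%E.
    apply: ge_ereal_sup => _ [x bx [y by_ <-]]; rewrite lee_fin.
    have := cabsB (x - a) (y - a).
    rewrite (_ : x - a - (y - a) = x - y); last by ring.
    have := bs x bx; have := bs y by_.
    have : expR (- (2 * L)) * r <= 2^-1 * r by rewrite ler_pM2r.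
    by lra.
  by rewrite leNgt rdiam.
have := @boundary_gap_bound _ Om K a (ln r - 2 * L) (ln r - L) (ln r) c
  1 eps (fun=> 1) oOm cOm kd ba nb big.
have lowK' z : Om z -> dist_boundary Om z < eps -> c / (dist_boundary Om z ^+ 2 * 1) <= K z.
  by move=> Oz dz; rewrite mulr1; exact: lowK.
move=> /(_ lowK' c0) H.
have Lp : 0 < L by lra.
have {H} : Num.sqrt (2 * pi * c / 1) <= (Num.sqrt (2 * L))^-1 + 3 * (L^-1 + L^-1).
  rewrite (_ : 2 * L = ln r - (ln r - 2 * L)); last by ring.
  rewrite {2}(_ : L = ln r - (ln r - L)); last by ring.
  rewrite {3}(_ : L = ln r - L - (ln r - 2 * L)); last by ring.
  apply: H; [|by move=> d _; rewrite ltr01 lexx|lra|lra].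
  have q0 : 0 < (2 * M + 1) / eps by rewrite divr_gt0//; lra.
  rewrite -ler_expR lnK ?posrE// ler_pdivrMr// in Leps.
  rewrite expRB rE ltr_pdivrMr ?expR_gt0// [ltRHS]mulrC; lra.
pose y := (Num.sqrt L)^-1.
have y1 : 0 < y by rewrite invr_gt0 sqrtr_gt0.
have yL : L^-1 = y * y by rewrite -expr2 exprVn (sqr_sqrtr (ltW Lp)).
have -> : (Num.sqrt (2 * L))^-1 + 3 * (L^-1 + L^-1) = f y.
  by rewrite sqrtrM// invfM yL -/y /f; ring.
rewrite divr1; apply/negP; rewrite -ltNge; apply: fy => //.
by apply: inv_sqrt_lt => //; lra.
Qed.

End asymptotics.

Theorem theorem1p1 (R : realType) (Om : set (cplx R)) (K : cplx R -> R) :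
  open Om -> connected Om -> Om !=set0 -> Om <> setT ->
  bergman_kernel_diag Om K ->
  [/\
   (* (1) *)
   (bounded_cset Om ->
    (exists c : R, 0 < c /\ near_boundary Om
       (fun z => c / dist_boundary Om z ^+ 2 <= K z)) ->
    uniformly_perfect (boundary Om)),
   (* (2) *)
   (forall M : R, 0 < M ->
    near_boundary Om
      (fun z => M / (dist_boundary Om z ^+ 2 * ln (dist_boundary Om z)^-1)
                <= K z) ->
    (exists alpha : R, 1 < alpha /\ condU1 alpha (boundary Om)) /\
    ((2 * pi)^-1 < M ->
     exists alpha : R, 1 < alpha < 2 /\ condU1 alpha (boundary Om)))
   &
   (* (3) *)
   ((exists c : R, 0 < c /\ near_boundary Om
       (fun z => c / (dist_boundary Om z ^+ 2 *
                      ln (ln (dist_boundary Om z)^-1)) <= K z)) ->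
    exists beta : R, 0 < beta /\ condU2 beta (boundary Om))].
Proof.
move=> oOm cOm Om0 _ kd; have pi0 := pi_gt0 R; split.
- by move=> bOm [c [c0 lowK]]; exact: uniformly_perfect_of_kernel lowK.
- move=> M M0 lowK; have q0 : 0 < 2 * pi * M by rewrite !mulr_gt0.
  split.
    (* Any [g] with [2 * pi * M * g > 1] would serve; this one gives the value 2. *)
    exists (1 + 2 / (2 * pi * M)); split; first by rewrite ltrDl divr_gt0.
    apply: condU1_of_kernel lowK => //; first by rewrite divr_gt0.
    by rewrite mulrC divfK ?gt_eqF// ltr1n.
  move=> Mpi; have q1 : 1 < 2 * pi * M by rewrite -ltr_pdivrMl ?mulr_gt0// mulr1.
  (* The midpoint between the threshold [1 / (2 pi M)] and 1, an interval that is nonempty exactly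
     because [M > 1 / (2 pi)]. *)
  pose g := ((2 * pi * M)^-1 + 1) / 2.
  have i1 : (2 * pi * M)^-1 < 1 by rewrite invf_lt1.
  have i0 : 0 < (2 * pi * M)^-1 by rewrite invr_gt0.
  exists (1 + g); split; first by rewrite /g; apply/andP; split; lra.
  apply: condU1_of_kernel lowK => //; first by rewrite /g; lra.
  have h : (2 * pi * M)^-1 < g by rewrite /g; lra.
  by rewrite -ltr_pdivrMl// mulr1.
- move=> [c [c0 lowK]]; exists (4 / (pi * c)).
  by split; [rewrite divr_gt0// mulr_gt0|exact: condU2_of_kernel lowK].
Qed.
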